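(* Let $(X^{m+1},g)$, $m>1$, be a causally simple spacetime that does not admit a metric $g'$ such that $(X,g')$ is refocussing and causally simple. Suppose that $(X,g)$ is conformally embedded as an open subset into a globally hyperbolic spacetime $(\widetilde X,\widetilde g)$ of the same dimension, such that the space of light rays $\mathcal N_X$ of $(X,g)$ is an open contact submanifold of the space of light rays $\mathcal N_{\widetilde X}$ of $(\widetilde X,\widetilde g)$ (via the map sending a light ray of $(X,g)$ to the light ray of $(\widetilde X,\widetilde g)$ containing it). Suppose moreover that: (1) in $(\widetilde X,\widetilde g)$, the Legendrian link in $\mathcal N_{\widetilde X}$ consisting of the skies of any two causally related points (that do not belong to the same null geodesic) is not Legendrian isotopic to the unlink; (2) every pair of causally unrelated events $x,y\in X$ remains causally unrelated when considered as a pair of events in $(\widetilde X,\widetilde g)$. Then a Legendrian link in $\mathcal N_X$ formed by the skies of two causally unrelated events in $(X,g)$ and a Legendrian link in $\mathcal N_X$ formed by the skies of two causally related events in $(X,g)$ (that do not belong to the same null geodesic) are never Legendrian isotopic in $\mathcal N_X$.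
   Context: All manifolds are smooth ($C^\infty$). A spacetime $(X,g)$ is a time-oriented Lorentz manifold; its points are called events. The causal future $J^+(x)$ of $x\in X$ is the set of all points that can be reached from $x$ along future-directed non-spacelike (timelike or null velocity) curves, including $x$ itself; the causal past $J^-(x)$ is defined similarly. Two points $x,y$ are causally related if $y\in J^+(x)$ or $x\in J^+(y)$, and causally unrelated otherwise. A spacetime is causally simple if it has no closed non-spacelike trajectories and all the sets $J^{\pm}(x)$ are closed. It is globally hyperbolic if it has no closed non-spacelike trajectories and $J^+(x)\cap J^-(y)$ is compact for all events $x,y$. Both classes consist of strongly causal spacetimes (each point has arbitrarily small neighborhoods that no non-spacelike curve meets more than once). Two Lorentz manifolds $(X_1,g_1)$, $(X_2,g_2)$ are conformal if there are a diffeomorphism $\Phi:X_1\to X_2$ and a positive smooth function $\Omega:X_1\to(0,+\infty)$ with $\Omega g_1=\Phi^*(g_2)$ (compatible with time orientations). A conformal embedding as an open subset is a conformal diffeomorphism onto an open subset with the restricted metric; $X$ is identified with its image. Null geodesics are preserved up to reparameterization by conformal maps. Space of light rays: for strongly causal $(X^{m+1},g)$, $\mathcal N_X$ denotes the space of all inextendible future-directed null geodesics of $(X,g)$ up to orientation-preserving reparameterization (light rays). It has a canonical structure of a (possibly non-Hausdorff) contact manifold of dimension $2m-1$: the contact hyperplane at a light ray $\gamma$ consists of the tangent vectors represented by Jacobi fields $J$ of variations of $\gamma$ through null geodesics with $g(J,\dot\gamma)=0$. The sky $\mathfrak S_x\subset\mathcal N_X$ of $x\in X$ is the set of all light rays through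 $x$; it is an embedded Legendrian $(m-1)$-sphere. The link $(\mathfrak S_x,\mathfrak S_y)$ is nonsingular (its components are disjoint) exactly when $x,y$ do not lie on the same null geodesic. A Legendrian isotopy of a two-component link is a smooth one-parameter family of nonsingular links (pairs of disjoint embedded Legendrian submanifolds). The unlink in $\mathcal N_{\widetilde X}$, for globally hyperbolic $(\widetilde X,\widetilde g)$, is the Legendrian isotopy class of links formed by the skies of two causally unrelated points of $(\widetilde X,\widetilde g)$ (all such links belong to one class). Refocussing: a strongly causal spacetime $(X,g)$ is refocussing at $x\in X$ if there exists a neighborhood $V\ni x$ such that for every open $U$ with $x\in U\subset V$ there exists $y\notin U$ such that all the null geodesics through $y$ enter $U$. It is refocussing if it is refocussing at some $x\in X$. *)

(* Defs.v *)
From HB Require Import structures.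
From mathcomp Require Import all_boot all_order all_algebra.
From mathcomp Require Import all_classical all_reals all_analysis.
Set Implicit Arguments.
Unset Strict Implicit.
Unset Printing Implicit Defensive.
Import Order.TTheory GRing.Theory Num.Theory.
Import numFieldNormedType.Exports.
Local Open Scope classical_set_scope.
Local Open Scope ring_scope.

(* Every point x of a manifold has a preferred chart [chart_at x], and the
   tangent space at x is 'rV_n, read in that chart; the notions below do not
   depend on the choice of preferred charts.  Metrics have signature
   (-,+,...,+). *)

(* All directional derivatives of order at most k exist on U and are
   continuous there.  Only used with V, W finite-dimensional and U open. *)
Fixpoint Ck (R : realType) (V W : normedModType R) (k : nat)
    (U : set V) (f : V -> W) : Prop :=
  (forall x, U x -> {for x, continuous f}) /\
  (if k is k'.+1 then
     forall v, (forall x, U x -> derivable f x v) /\ Ck k' U ('D_v f)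
   else True).

Definition smooth_on (R : realType) (V W : normedModType R)
  (U : set V) (f : V -> W) : Prop := forall k, Ck k U f.

(* [cmap] is only meaningful on [cdom], and [cinv] on [cmap @` cdom]. *)
Record chart (R : realType) (M : topologicalType) (n : nat) := Chart {
  cdom : set M;
  cmap : M -> 'rV[R]_n;
  cinv : 'rV[R]_n -> M }.

Definition crange (R : realType) (M : topologicalType) (n : nat)
  (k : chart R M n) : set 'rV[R]_n := cmap k @` cdom k.

Definition is_chart (R : realType) (M : topologicalType) (n : nat)
    (k : chart R M n) : Prop :=
  [/\ open (cdom k), open (crange k),
      (forall x, cdom k x -> cinv k (cmap k x) = x),
      (forall x, cdom k x -> {for x, continuous (cmap k)}) &
      (forall y, crange k y -> {for y, continuous (cinv k)})].

Record manifold (R : realType) (n : nat) := Manifold {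
  msort :> topologicalType;
  msort_hausdorff : hausdorff_space msort;
  msort_countable : @second_countable msort;
  atlas : set (chart R msort n);
  chart_at : msort -> chart R msort n;
  atlas_chart : forall k, atlas k -> is_chart k;
  atlas_smooth : forall k k', atlas k -> atlas k' ->
    smooth_on (cmap k @` (cdom k `&` cdom k')) (cmap k' \o cinv k);
  chart_at_atlas : forall x, atlas (chart_at x);
  chart_at_dom : forall x, cdom (chart_at x) x }.

Section Manifolds.
Context {R : realType} {n : nat}.

Definition smooth_map (M : manifold R n) (V : normedModType R) (U : set V)
    (f : V -> M) : Prop :=
  (forall u, U u -> {for u, continuous f}) /\
  (forall k, atlas k -> smooth_on (U `&` f @^-1` cdom k) (cmap k \o f)).

(* The components in the chart k of w : T_x M; [of_chart] is the inverse. *)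
Definition to_chart (M : manifold R n) (k : chart R M n) (x : M)
  (w : 'rV[R]_n) : 'rV[R]_n :=
  'D_w (cmap k \o cinv (chart_at x)) (cmap (chart_at x) x).

Definition of_chart (M : manifold R n) (k : chart R M n) (x : M)
  (w : 'rV[R]_n) : 'rV[R]_n :=
  'D_w (cmap (chart_at x) \o cinv k) (cmap k x).

(* u |-> (x u, v u) is a smooth map from U to the tangent bundle. *)
Definition smooth_tangent_map (M : manifold R n) (V : normedModType R)
    (U : set V) (x : V -> M) (v : V -> 'rV[R]_n) : Prop :=
  smooth_map U x /\
  (forall k, atlas k ->
     smooth_on (U `&` x @^-1` cdom k) (fun u => to_chart k (x u) (v u))).

Definition smooth_vector_field (M : manifold R n) (U : set M)
    (X : M -> 'rV[R]_n) : Prop :=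
  forall k, atlas k ->
    smooth_on (cmap k @` (cdom k `&` U))
      (fun y => to_chart k (cinv k y) (X (cinv k y))).

Definition smooth_function (M : manifold R n) (U : set M) (f : M -> R) : Prop :=
  forall k, atlas k -> smooth_on (cmap k @` (cdom k `&` U)) (f \o cinv k).

Definition velocity (M : manifold R n) (c : R -> M) (t : R) : 'rV[R]_n :=
  derive1 (cmap (chart_at (c t)) \o c) t.

Definition smooth_between (M M' : manifold R n) (U : set M) (F : M -> M') :
    Prop :=
  (forall x, U x -> {for x, continuous F}) /\
  (forall k k', atlas k -> atlas k' ->
     smooth_on (cmap k @` (cdom k `&` U `&` F @^-1` cdom k'))
       (cmap k' \o F \o cinv k)).

Definition differential_at (M M' : manifold R n) (F : M -> M') (x : M)
  (v : 'rV[R]_n) : 'rV[R]_n :=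
  'D_v (cmap (chart_at (F x)) \o F \o cinv (chart_at x)) (cmap (chart_at x) x).

Definition gform (M : manifold R n) (g : M -> 'M[R]_n) (x : M)
  (v w : 'rV[R]_n) : R := (v *m g x *m w^T) 0 0.

(* The matrix g_ij at the point of coordinates y in the chart k. *)
Definition gmat (M : manifold R n) (g : M -> 'M[R]_n) (k : chart R M n)
  (y : 'rV[R]_n) : 'M[R]_n :=
  \matrix_(i, j) gform g (cinv k y)
    (of_chart k (cinv k y) (delta_mx 0 i))
    (of_chart k (cinv k y) (delta_mx 0 j)).

Definition gpartial (M : manifold R n) (g : M -> 'M[R]_n) (k : chart R M n)
  (y : 'rV[R]_n) (l i j : 'I_n) : R :=
  'D_(delta_mx 0 l) (fun z => gmat g k z i j) y.

(* Gamma^i_jl for the Levi-Civita connection. *)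
Definition christoffel (M : manifold R n) (g : M -> 'M[R]_n)
  (k : chart R M n) (y : 'rV[R]_n) (i j l : 'I_n) : R :=
  2^-1 * \sum_(p < n) invmx (gmat g k y) i p *
    (gpartial g k y j p l + gpartial g k y l p j - gpartial g k y p j l).

Definition geodesic_on (M : manifold R n) (g : M -> 'M[R]_n) (I : set R)
    (c : R -> M) : Prop :=
  smooth_map I c /\
  (forall k t, atlas k -> I t -> cdom k (c t) -> forall i : 'I_n,
     let q j := fun s : R => cmap k (c s) 0 j in
     derive1 (derive1 (q i)) t +
     \sum_(j < n) \sum_(l < n)
       christoffel g k (cmap k (c t)) i j l * derive1 (q j) t * derive1 (q l) t
     = 0).

End Manifolds.

(* A time orientation is given by its cones [future] of future-directed
   non-spacelike (hence nonzero) vectors, which are locally those in the same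
   half-cone as a smooth timelike vector field. *)
Record spacetime (R : realType) (m : nat) (M : manifold R m.+1) := Spacetime {
  metric : M -> 'M[R]_m.+1;
  future : M -> set 'rV[R]_m.+1;
  metric_sym : forall x, (metric x)^T = metric x;
  metric_lorentz : forall x, exists2 P : 'M[R]_m.+1, P \in unitmx &
    P *m metric x *m P^T = diag_mx (\row_i (if i == 0 then -1 else 1));
  metric_smooth : forall k, atlas k -> forall i j : 'I_m.+1,
    smooth_on (crange k) (fun y => gmat metric k y i j);
  future_cone : forall x0, exists (U : set M) (T : M -> 'rV[R]_m.+1),
    [/\ open U, U x0, smooth_vector_field U T &
     forall x, U x ->
       gform metric x (T x) (T x) < 0 /\
       forall v, future x v <->
         [/\ v != 0, gform metric x v v <= 0 & gform metric x v (T x) < 0]] }.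

Section Causality.
Context {R : realType} {m : nat} {M : manifold R m.+1} (g : spacetime M).

Definition causal_curve (a b : R) (c : R -> M) : Prop :=
  a < b /\ exists I : set R, [/\ open I, (forall t, a <= t <= b -> I t), smooth_map I c &
    forall t, a <= t <= b -> future g (c t) (velocity c t)].

Definition causal_future (x : M) : set M :=
  [set y | y = x \/ exists a b c, [/\ causal_curve a b c, c a = x & c b = y]].

Definition causal_past (x : M) : set M :=
  [set y | y = x \/ exists a b c, [/\ causal_curve a b c, c a = y & c b = x]].

Definition causally_related (x y : M) : Prop :=
  causal_future x y \/ causal_future y x.

Definition causally_unrelated (x y : M) : Prop := ~ causally_related x y.

Definition no_closed_causal_curve : Prop :=
  forall a b c, causal_curve a b c -> c a <> c b.

Definition causally_simple : Prop :=
  no_closed_causal_curve /\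
  forall x, closed (causal_future x) /\ closed (causal_past x).

Definition globally_hyperbolic : Prop :=
  no_closed_causal_curve /\
  forall x y, compact (causal_future x `&` causal_past y).

Definition null_geodesic (I : set R) (c : R -> M) : Prop :=
  [/\ open I, is_interval I, I !=set0, geodesic_on (metric g) I c &
   forall t, I t -> future g (c t) (velocity c t) /\
     gform (metric g) (c t) (velocity c t) (velocity c t) = 0].

Definition future_endpoint (I : set R) (c : R -> M) (p : M) : Prop :=
  forall W, nbhs p W -> exists2 t0, I t0 &
    forall t, I t -> t0 <= t -> W (c t).

Definition past_endpoint (I : set R) (c : R -> M) (p : M) : Prop :=
  forall W, nbhs p W -> exists2 t0, I t0 &
    forall t, I t -> t <= t0 -> W (c t).

Definition inextendible (I : set R) (c : R -> M) : Prop :=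
  forall p, ~ future_endpoint I c p /\ ~ past_endpoint I c p.

(* c on I is an arc of c' on I', up to orientation-preserving
   reparametrization. *)
Definition sub_arc (I : set R) (c : R -> M) (I' : set R) (c' : R -> M) :
    Prop :=
  exists h : R -> R, [/\ smooth_on I h, (forall t, I t -> 0 < derive1 h t),
    h @` I `<=` I' & forall t, I t -> c t = c' (h t)].

Definition reparametrization (I : set R) (c : R -> M) (I' : set R)
    (c' : R -> M) : Prop :=
  exists h : R -> R, [/\ smooth_on I h, (forall t, I t -> 0 < derive1 h t),
    h @` I = I' & forall t, I t -> c t = c' (h t)].

(* A light ray is an equivalence class of inextendible null geodesics (pairs
   of an interval and a curve) under reparametrization. *)
Definition is_ray (L : set (set R * (R -> M))) : Prop :=
  exists (I : set R) (c : R -> M), [/\ null_geodesic I c, inextendible I c &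
    L = [set d | [/\ null_geodesic d.1 d.2, inextendible d.1 d.2 &
                     reparametrization d.1 d.2 I c]]].

Definition light_ray : Type := {L : set (set R * (R -> M)) | is_ray L}.

Definition represents (I : set R) (c : R -> M) (L : light_ray) : Prop :=
  sval L (I, c).

Definition arc_of (I : set R) (c : R -> M) (L : light_ray) : Prop :=
  exists I' c', represents I' c' L /\ sub_arc I c I' c'.

Definition through (L : light_ray) (x : M) : Prop :=
  exists I c t, [/\ represents I c L, I t & c t = x].

Definition sky (x : M) : set light_ray := [set L | through L x].

Definition on_same_null_geodesic (x y : M) : Prop :=
  exists L, through L x /\ through L y.

Definition refocussing_at (x : M) : Prop :=
  exists2 V, nbhs x V &
    forall U, open U -> U x -> U `<=` V ->
      exists2 y, ~ U y &
        forall L, through L y -> exists2 z, U z & through L z.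

Definition refocussing : Prop := exists x, refocussing_at x.

End Causality.

Arguments sky {R m M} g x.

(* In a strongly causal spacetime the space of light rays is a (possibly
   non-Hausdorff) manifold, with the unique smooth structure for which the
   projection from the bundle of future null vectors, (x, v) |-> the ray
   through x with velocity v, is a submersion.  That structure is described
   here by its smooth maps: as a submersion has local sections, a map to the
   space of rays is smooth iff it lifts locally to a smooth map to the bundle of
   null vectors; a set of rays is open iff its preimage under every smooth
   family of rays is open; a real function is smooth iff it is smooth along
   every smooth family of rays. *)

Section LightRays.
Context {R : realType} {m : nat} {M : manifold R m.+1} (g : spacetime M).

Definition tangent_ray (L : light_ray g) (x : M) (v : 'rV[R]_m.+1) : Prop :=
  exists I c t, [/\ represents I c L, I t, c t = x & velocity c t = v].

Definition ray_smooth (V : normedModType R) (U : set V) (s : V -> light_ray g) :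
    Prop :=
  forall u, U u -> exists (U' : set V) (x : V -> M) (v : V -> 'rV[R]_m.+1),
    [/\ open U', U' u, U' `<=` U, smooth_tangent_map U' x v &
        forall u', U' u' -> tangent_ray (s u') (x u') (v u')].

Definition ray_open (O : set (light_ray g)) : Prop :=
  forall (k : nat) (U : set 'rV[R]_k) (s : 'rV[R]_k -> light_ray g),
    open U -> ray_smooth U s -> open (U `&` s @^-1` O).

Definition ray_function (O : set (light_ray g)) (f : light_ray g -> R) : Prop :=
  forall (k : nat) (U : set 'rV[R]_k) (s : 'rV[R]_k -> light_ray g),
    open U -> ray_smooth U s -> smooth_on (U `&` s @^-1` O) (f \o s).

Definition ray_curve (s : R -> light_ray g) : Prop :=
  exists2 e : R, 0 < e & ray_smooth [set a | - e < a < e] s.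

(* Tangent vectors of the space of rays are the velocities at 0 of its smooth
   curves, seen as derivations. *)
Definition same_velocity (s s' : R -> light_ray g) : Prop :=
  s 0 = s' 0 /\
  forall (O : set (light_ray g)) (f : light_ray g -> R),
    ray_open O -> O (s 0) -> ray_function O f ->
    derive1 (f \o s) 0 = derive1 (f \o s') 0.

Definition nonzero_velocity (s : R -> light_ray g) : Prop :=
  exists (O : set (light_ray g)) (f : light_ray g -> R),
    [/\ ray_open O, O (s 0), ray_function O f & derive1 (f \o s) 0 <> 0].

(* The velocity at 0 of s lies in the contact hyperplane at the ray s 0: it is
   represented by the Jacobi field J of a variation Gam of this ray through null
   geodesics, with g(J, d/dt Gam(0, t)) = 0. *)
Definition contact_velocity (s : R -> light_ray g) : Prop :=
  exists (e : R) (I : set R) (Gam : R * R -> M) (s' : R -> light_ray g),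
    [/\ 0 < e, smooth_map ([set a | - e < a < e] `*` I) Gam,
      (forall a, - e < a < e ->
         null_geodesic g I (fun t => Gam (a, t)) /\
         arc_of I (fun t => Gam (a, t)) (s' a)),
      same_velocity s' s &
      forall t, I t ->
        let J := velocity (fun a => Gam (a, t)) 0 in
        gform (metric g) (Gam (0, t)) J (velocity (fun r => Gam (0, r)) t) = 0].

Definition sphere : set 'rV[R]_m := [set w | \sum_i w 0 i ^+ 2 = 1].

Definition sphere_curve (w : R -> 'rV[R]_m) : Prop :=
  exists2 e : R, 0 < e &
    smooth_on [set a | - e < a < e] w /\ (forall a, - e < a < e -> sphere (w a)).

(* E restricts to an embedding of the sphere of dimension m - 1 with Legendrian
   image: injective, homeomorphic onto its image, immersive, and everywhere
   tangent to the contact hyperplanes. *)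
Definition legendrian_embedding (E : 'rV[R]_m -> light_ray g) : Prop :=
  [/\ (forall w w', sphere w -> sphere w' -> E w = E w' -> w = w'),
      (forall W, open W -> exists2 O, ray_open O &
         forall w, sphere w -> (W w <-> O (E w))),
      (forall w, sphere_curve w -> derive1 w 0 <> 0 ->
         nonzero_velocity (E \o w)) &
      (forall w, sphere_curve w -> contact_velocity (E \o w))].

(* F restricts to a smooth map on R x sphere: it maps smooth families of points
   of R x sphere to smooth families of rays. *)
Definition smooth_sphere_family (F : R -> 'rV[R]_m -> light_ray g) : Prop :=
  forall (k : nat) (U : set 'rV[R]_k) (r : 'rV[R]_k -> R)
    (w : 'rV[R]_k -> 'rV[R]_m),
    open U -> smooth_on U r -> smooth_on U w ->
    (forall u, U u -> sphere (w u)) ->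
    ray_smooth U (fun u => F (r u) (w u)).

(* Legendrian isotopy of links whose two (ordered) components are spheres.  The
   isotopy is defined at all times in R rather than in [0, 1], which amounts to
   the same thing by a reparametrization of time. *)
Definition legendrian_isotopic (L0 L1 : set (light_ray g) * set (light_ray g)) :
    Prop :=
  exists F G : R -> 'rV[R]_m -> light_ray g,
    [/\ smooth_sphere_family F /\ smooth_sphere_family G,
      (forall t, legendrian_embedding (F t) /\ legendrian_embedding (G t)),
      (forall t, F t @` sphere `&` G t @` sphere = set0),
      (F 0 @` sphere, G 0 @` sphere) = L0 &
      (F 1 @` sphere, G 1 @` sphere) = L1].

Definition sky_link (x y : M) : set (light_ray g) * set (light_ray g) :=
  (sky g x, sky g y).

Definition isotopic_to_unlink (L : set (light_ray g) * set (light_ray g)) :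
    Prop :=
  exists x y, causally_unrelated g x y /\ legendrian_isotopic L (sky_link x y).

End LightRays.

Arguments sky_link {R m M} g x y.

Section Embeddings.
Context {R : realType} {m : nat} {X Y : manifold R m.+1}.
Variables (g : spacetime X) (h : spacetime Y).

Definition conformal_open_embedding (Phi : X -> Y) : Prop :=
  [/\ injective Phi, open (range Phi), smooth_between setT Phi,
      (exists Psi : Y -> X,
         cancel Phi Psi /\ smooth_between (range Phi) Psi) &
      (exists Om : X -> R,
         [/\ smooth_function setT Om, (forall x, 0 < Om x),
           (forall x v w, Om x * gform (metric g) x v w =
              gform (metric h) (Phi x)
                (differential_at Phi x v) (differential_at Phi x w)) &
           (forall x v, future g x v <->
              future h (Phi x) (differential_at Phi x v))])].

(* The image under Phi of the ray L runs along the ray L'. *)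
Definition ray_contains (Phi : X -> Y) (L' : light_ray h) (L : light_ray g) :
    Prop :=
  exists I c, represents I c L /\ arc_of I (Phi \o c) L'.

(* i maps a light ray to the light ray containing it. *)
Definition ray_inclusion (Phi : X -> Y) (i : light_ray g -> light_ray h) :
    Prop :=
  forall L, ray_contains Phi (i L) L /\
    forall L', ray_contains Phi L' L -> L' = i L.

Definition open_contact_embedding (i : light_ray g -> light_ray h) : Prop :=
  [/\ injective i, ray_open (range i),
      (forall (k : nat) (U : set 'rV[R]_k) (s : 'rV[R]_k -> light_ray g),
         open U -> (ray_smooth U s <-> ray_smooth U (i \o s))) &
      (forall s, ray_curve s ->
         (contact_velocity s <-> contact_velocity (i \o s)))].

End Embeddings.

(* Main.v *)
From HB Require Import structures.
From mathcomp Require Import all_boot all_order all_algebra.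
From mathcomp Require Import all_classical all_reals all_analysis.
From mathcomp Require Import ring lra.
Require Import Defs.
Set Implicit Arguments.
Unset Strict Implicit.
Unset Printing Implicit Defensive.
Import Order.TTheory GRing.Theory Num.Theory.
Import numFieldNormedType.Exports.
Local Open Scope classical_set_scope.
Local Open Scope ring_scope.

(** Suppose that the skies of two unrelated events x, y were isotopic in the
    space of rays of X to the skies of two related events u, v. The map i is an
    open contact embedding, so it carries this isotopy to the space of rays of
    Xt ([legendrian_isotopic_image]). The point is that i maps the sky of x onto
    the whole sky of Phi x ([sky_image]). Then the skies of Phi u and Phi v are
    isotopic to those of Phi x and Phi y, which are unrelated by hypothesis,
    while Phi u and Phi v are related ([causally_related_image]) and do not lie
    on a common null geodesic ([on_same_null_geodesic_image]); this contradicts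
    the assumption that skies of related events are linked.

    That a ray of Xt through Phi x comes from a ray of X through x
    ([ray_pullback]) is the conformal invariance of null geodesics. Let d be the
    part of the ray in X, where the metric of Xt is Om g. The geodesic equation
    is treated as the Euler-Lagrange equation of the energy
    ([geodesic_euler_lagrange]). This equation is invariant under changes of
    coordinates by the symmetry of second derivatives
    ([euler_lagrange_pullback]), and for null curves the factor Om can be
    absorbed by the parameter change k with k' = Om(d o k)
    ([euler_lagrange_conformal]). Such a k is the inverse of a primitive of
    1 / Om(d). A maximal piece of the ray inside the open image of X has no
    endpoint in X ([no_upper_limit]), so the resulting geodesic of X is
    inextendible.

    The calculus behind this (differentiability of maps with continuous
    directional derivatives, the chain rule and stability of [Ck] under
    composition, symmetry of second derivatives) rests on the mean value
    theorem. *)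

(** * Iterated differentiability *)

Section CkBasics.
Context {R : realType}.
Implicit Types V W : normedModType R.

Lemma Ck_sub V W k (U U' : set V) (f : V -> W) :
  U' `<=` U -> Ck k U f -> Ck k U' f.
Proof.
elim: k f => [|k IH] f sU /= [cf df]; (split; first by move=> x /sU; exact: cf).
  by [].
by move=> v; have [dv Cv] := df v; split; [move=> x /sU; exact: dv|exact: IH].
Qed.

(** [Ck] only asks for properties of [f] at each point of the set, so it can be
    checked one point at a time. *)
Lemma Ck_pointwise V W k (U : set V) (f : V -> W) :
  (forall x, U x -> Ck k [set x] f) -> Ck k U f.
Proof.
elim: k f => [|k IH] f H /=.
  by split=> // x /H [+ _]; exact.
split; first by move=> x /H [+ _]; exact.
move=> v; split; first by move=> x /H [_ /(_ v) [+ _]]; exact.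
by apply: IH => x /H [_ /(_ v) []].
Qed.

Lemma Ck_pred V W k (U : set V) (f : V -> W) : Ck k.+1 U f -> Ck k U f.
Proof.
elim: k f => [|k IH] f /= [cf df]; split => // v.
by have [dv Cv] := df v; split => //; exact: IH.
Qed.

Lemma Ck_near_eq V W k (x : V) (f g : V -> W) :
  (\near x, f x = g x) -> Ck k [set x] f -> Ck k [set x] g.
Proof.
elim: k f g => [|k IH] f g fg /= [cf df].
  split=> // _ ->.
  rewrite /prop_for /continuous_at -(nbhs_singleton fg).
  by apply: cvg_trans (cf x erefl); apply: near_eq_cvg; apply: filterS fg => y ->.
split.
  move=> _ ->; rewrite /prop_for /continuous_at -(nbhs_singleton fg).
  by apply: cvg_trans (cf x erefl); apply: near_eq_cvg; apply: filterS fg => y ->.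
move=> v; have [dv Cv] := df v; split.
  by move=> _ ->; apply: near_eq_derivable (dv _ erefl).
apply: IH Cv.
move: fg => /near_join; apply: filterS => y fgy.
exact: near_eq_derive.
Unshelve. all: by end_near. Qed.

(** The derivatives at a point see the values around it, hence the open set. *)
Lemma Ck_eq V W k (U : set V) (f g : V -> W) :
  open U -> {in U, f =1 g} -> Ck k U f -> Ck k U g.
Proof.
move=> oU fg Cf; apply: Ck_pointwise => x Ux.
apply: (@Ck_near_eq _ _ _ _ f); last by apply: Ck_sub Cf => _ ->.
by near=> y; apply: fg; rewrite inE; near: y; exact: open_nbhs_nbhs.
Unshelve. all: by end_near. Qed.

Lemma Ck_local V W k (U : set V) (f : V -> W) :
  (forall x, U x -> exists2 U', U' x & Ck k (U `&` U') f) -> Ck k U f.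
Proof.
move=> H; apply: Ck_pointwise => x Ux; have [U' U'x C] := H _ Ux.
by apply: Ck_sub C => _ ->.
Qed.

Lemma continuous_rV n (T : topologicalType) (x : T) (f : T -> 'rV[R]_n) :
  (forall j, {for x, continuous (fun y => f y 0 j)}) -> {for x, continuous f}.
Proof.
move=> H; apply/cvgrPdist_lt => e e0.
have : \forall y \near x, forall j, `|f x 0 j - f y 0 j| < e.
  by apply: filter_forall => j; have /cvgrPdist_lt/(_ e e0) := H j.
apply: filterS => y Hy.
rewrite [ltLHS]/Num.norm/= mx_normrE; apply/bigmax_ltP; split => // -[i j] _ /=.
by rewrite (ord1 i) !mxE; exact: Hy.
Qed.

Lemma continuous_coord n (T : topologicalType) (x : T) (f : T -> 'rV[R]_n) j :
  {for x, continuous f} -> {for x, continuous (fun y => f y 0 j)}.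
Proof.
move=> cf; have := cvg_comp f (fun M : 'rV[R]_n => M 0 j) cf; apply.
exact: coord_continuous.
Qed.

Lemma Ck_rV V n k (U : set V) (f : V -> 'rV[R]_n) :
  open U -> Ck k U f <-> forall j, Ck k U (fun x => f x 0 j).
Proof.
move=> oU; split.
  elim: k f => [|k IH] f /= [cf df] j; (split;
      first by move=> x Ux; apply: continuous_coord; exact: cf).
    by [].
  move=> v; have [dv Cv] := df v; split.
    by move=> x /dv /derivable_mxP /(_ 0 j).
  have := IH _ Cv j; apply: Ck_eq => // x /set_mem /dv dx.
  by rewrite derive_mx // mxE.
elim: k f => [|k IH] f /= H.
  by split=> // x Ux; apply: continuous_rV => j; have [+ _] := H j; exact.
split; first by move=> x Ux; apply: continuous_rV => j; have [+ _] := H j; exact.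
move=> v; have dv x : U x -> derivable f x v.
  move=> Ux; apply/derivable_mxP => i j; rewrite (ord1 i).
  by have [_ /(_ v)[+ _]] := H j; exact.
split=> //; apply: IH => j; have [_ /(_ v)[_]] := H j.
by apply: Ck_eq => // x /set_mem /dv dx; rewrite [in RHS]derive_mx // mxE.
Qed.

Lemma Ck_cst V W k (U : set V) (c : W) : Ck k U (fun=> c).
Proof.
elim: k c => [|k IH] c /=; (split; first by move=> x _; exact: cst_continuous).
  by [].
move=> v; split; first by move=> x _; exact: derivable_cst.
rewrite (_ : 'D_v _ = fun=> 0); first exact: IH.
by apply/funext => x; exact: derive_cst.
Qed.

Lemma Ck_add V W k (U : set V) (f g : V -> W) : open U ->
  Ck k U f -> Ck k U g -> Ck k U (fun x => f x + g x).
Proof.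
move=> oU; elim: k f g => [|k IH] f g /= [cf df] [cg dg];
  (split; first by move=> x Ux; apply: continuousD; [exact: cf|exact: cg]).
  by [].
move=> v; have [dfv Cf] := df v; have [dgv Cg] := dg v; split.
  by move=> x Ux; apply: derivableD; [exact: dfv|exact: dgv].
have := IH _ _ Cf Cg; apply: Ck_eq => // x /set_mem Ux.
by rewrite -deriveD //; [exact: dfv|exact: dgv].
Qed.

Lemma Ck_mul V k (U : set V) (f g : V -> R) : open U ->
  Ck k U f -> Ck k U g -> Ck k U (fun x => f x * g x).
Proof.
move=> oU; elim: k f g => [|k IH] f g /=.
  by move=> [cf _] [cg _]; split=> // x Ux; apply: continuousM; [exact: cf|exact: cg].
move=> Cf Cg; have Cf' := @Ck_pred _ _ _ _ _ Cf; have Cg' := @Ck_pred _ _ _ _ _ Cg.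
move: Cf Cg => [cf df] [cg dg].
split; first by move=> x Ux; apply: continuousM; [exact: cf|exact: cg].
move=> v; have [dfv Cfv] := df v; have [dgv Cgv] := dg v; split.
  by move=> x Ux; apply: derivableM; [exact: dfv|exact: dgv].
have := Ck_add oU (IH _ _ Cf' Cgv) (IH _ _ Cg' Cfv).
apply: Ck_eq => // x /set_mem Ux.
by rewrite deriveM //; [exact: dfv|exact: dgv].
Qed.

Lemma Ck_sum V (I : Type) (r : seq I) k (U : set V) (F : I -> V -> R) : open U ->
  (forall i, Ck k U (F i)) -> Ck k U (fun x => \sum_(i <- r) F i x).
Proof.
move=> oU H; elim: r => [|i r IH].
  rewrite (_ : (fun=> _) = fun=> 0); first exact: Ck_cst.
  by apply/funext => x; rewrite big_nil.
rewrite (_ : (fun=> _) = fun x => F i x + \sum_(i <- r) F i x).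
  exact: Ck_add.
by apply/funext => x; rewrite big_cons.
Qed.

Lemma Ck_comp_linear V V' W k (U : set V) (f : V -> W) (L : {linear V' -> V}) :
  continuous L -> Ck k U f -> Ck k (L @^-1` U) (f \o L).
Proof.
move=> cL; elim: k f => [|k IH] f /= [cf df];
  (split; first by move=> x Ux; apply: continuous_comp; [exact: cL|exact: cf]).
  by [].
have E v x : (fun h : R => h^-1 *: ((f \o L) (h *: v + x) - (f \o L) x)) =
    (fun h : R => h^-1 *: (f (h *: L v + L x) - f (L x))).
  by apply/funext => h /=; rewrite linearP.
move=> v; have [dv Cv] := df (L v); split.
  by move=> x /dv; rewrite /derivable /= E.
rewrite (_ : 'D_v _ = 'D_(L v) f \o L); first exact: IH.
by apply/funext => x; rewrite /derive /= E.
Qed.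

Lemma Ck_linear V W k (U : set V) (L : {linear V -> W}) :
  continuous L -> Ck k U L.
Proof.
move=> cL; case: k => [|k] /=; (split; first by move=> x _; exact: cL) => // v.
have H x : is_derive x v L (L v).
  apply: DeriveDef; first exact/diff_derivable/linear_differentiable.
  by rewrite deriveE ?diff_lin //; exact/linear_differentiable.
split; first by move=> x _; case: (H x).
rewrite (_ : 'D_v _ = fun=> L v); first exact: Ck_cst.
by apply/funext => x; exact: derive_val.
Qed.

End CkBasics.

(** * Continuous partial derivatives and the chain rule *)

Section Differentiability.
Context {R : realType}.

(** The mean value theorem on the segment between 0 and t, for either sign of t. *)
Lemma mean_value_bound (g : R -> R) (d e t : R) :
  (forall s, `|s| <= `|t| -> derivable g s 1 /\ `|'D_1 g s - d| <= e) ->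
  `|g t - g 0 - t * d| <= e * `|t|.
Proof.
move=> H.
have K a b : (forall s, a <= s <= b -> derivable g s 1 /\ `|'D_1 g s - d| <= e) ->
    a <= b -> `|g b - g a - (b - a) * d| <= e * (b - a).
  move=> Hab ab.
  have dg s : s \in `]a, b[%R -> is_derive s 1 g ('D_1 g s).
    rewrite in_itv /= => /andP[/ltW as_ /ltW sb].
    by apply: DeriveDef => //; have [] := Hab s; rewrite ?as_ ?sb.
  have cg : {within `[a, b], continuous g}.
    apply: derivable_within_continuous => s; rewrite in_itv /= => sab.
    by have [] := Hab s sab.
  have [s] := MVT_segment ab dg cg.
  rewrite in_itv /= => /Hab [_ sd] ->.
  by rewrite [_ * d]mulrC -mulrBl normrM [X in _ * X <= _]ger0_norm ?subr_ge0 //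
     ler_wpM2r // subr_ge0.
have [t0|t0] := leP 0 t.
  have := K 0 t; rewrite subr0 (ger0_norm t0); apply => // s /andP[s0 st].
  by apply: H; rewrite !ger0_norm.
have := K t 0; rewrite sub0r (ltr0_norm t0) => KK.
rewrite -normrN (_ : - (g t - g 0 - t * d) = g 0 - g t - - t * d); last by ring.
apply: KK; last exact: ltW.
move=> s /andP[ts s0]; apply: H.
by rewrite !ler0_norm ?lerN2 // ltW.
Qed.

Lemma differentiable_approx (V W : normedModType R) (f : V -> W)
    (df : {linear V -> W}) x : continuous df ->
  (forall e, 0 < e -> \forall h \near 0, `|f (h + x) - f x - df h| <= e * `|h|) ->
  differentiable f x.
Proof.
move=> cdf H.
have H' : f \o shift x = cst (f x) + df +o_ 0 id.
  apply/eqaddoP => /= e e0; apply: filterS (H e e0) => h.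
  rewrite [X in _ -> `|X| <= _](_ : _ = f (h + x) - f x - df h) //.
  by rewrite -addrA -opprD.
by apply/diff_locallyP; rewrite (diff_unique cdf H').
Qed.

Variable n : nat.
Implicit Types (f : 'rV[R]_n -> R) (v : 'rV[R]_n).

Let e_ (j : 'I_n) : 'rV[R]_n := delta_mx 0 j.

(** The candidate for the differential of f at x: the linear form whose
    coefficients are the partial derivatives. *)
Definition partial_form f x v : R := \sum_(j < n) v 0 j * 'D_(e_ j) f x.

Lemma partial_form_linear f x : linear (partial_form f x).
Proof.
move=> a u v; rewrite /partial_form scaler_sumr -big_split /=; apply: eq_bigr => j _.
by rewrite !mxE mulrDl -mulrA.
Qed.

HB.instance Definition _ f x :=
  GRing.isLinear.Build R 'rV[R]_n R _ (partial_form f x) (partial_form_linear f x).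

Lemma coord_le_norm v j : `|v 0 j| <= `|v|.
Proof.
rewrite [leRHS]/Num.norm/= mx_normrE.
exact: (le_bigmax _ (fun ij : 'I_1 * 'I_n => `|v ij.1 ij.2|) (0, j)).
Qed.

Lemma coord_norm_lt v d : 0 < d -> (forall j, `|v 0 j| < d) -> `|v| < d.
Proof.
move=> d0 H; rewrite [ltLHS]/Num.norm/= mx_normrE.
by apply/bigmax_ltP; split => // -[i j] _ /=; rewrite (ord1 i).
Qed.

(** From x, the increment h is added one coordinate after the other; each step
    is controlled by the mean value bound, and the errors add up to at most n
    times the oscillation e of the partial derivatives. *)
Lemma partial_form_bound f x d e : 0 < d -> 0 <= e ->
  (forall j y, `|y - x| < d -> derivable f y (e_ j) /\
     `|'D_(e_ j) f y - 'D_(e_ j) f x| <= e) ->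
  forall h, `|h| < d -> `|f (h + x) - f x - partial_form f x h| <= n%:R * e * `|h|.
Proof.
move=> d0 e0 H h hd.
pose hm m : 'rV[R]_n := \row_i (if (i < m)%N then h 0 i else 0).
suff K m : (m <= n)%N ->
    `|f (hm m + x) - f x - \sum_(j < n | (j < m)%N) h 0 j * 'D_(e_ j) f x|
      <= m%:R * e * `|h|.
  have := K n (leqnn n); rewrite (_ : hm n = h); last first.
    by apply/rowP => i; rewrite !mxE ltn_ord.
  by under eq_bigl do rewrite ltn_ord.
elim: m => [_|m IH mn].
  rewrite (_ : hm 0%N = 0); last by apply/rowP => i; rewrite !mxE.
  by rewrite add0r subrr big_pred0 // subrr normr0 !mul0r.
pose j := Ordinal mn.
rewrite (bigD1 j) //= (eq_bigl (fun i : 'I_n => (i < m)%N)); last first.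
  by move=> i; rewrite ltnS -val_eqE /= ltn_neqAle andbC.
have -> : hm m.+1 = h 0 j *: e_ j + hm m.
  apply/rowP => i; rewrite !mxE eqxx /= ltnS leq_eqVlt -val_eqE /=.
  case: eqVneq => [im|_] /=; last by rewrite mulr0 add0r.
  by rewrite im ltnn mulr1 addr0; congr (h 0 _); exact/val_inj.
pose g s := f (s *: e_ j + (hm m + x)).
have Hs s : `|s| <= `|h 0 j| -> `|(s *: e_ j + (hm m + x)) - x| < d.
  move=> sh; rewrite addrA addrK; apply: coord_norm_lt => // i.
  rewrite !mxE eqxx /=; have [->|ij] := eqVneq i j.
    rewrite mulr1 ltnn addr0; apply: le_lt_trans hd; exact: le_trans sh (coord_le_norm _ _).
  rewrite mulr0 add0r; case: ifP => _; last by rewrite normr0.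
  exact: le_lt_trans (coord_le_norm _ _) hd.
have dg s : `|s| <= `|h 0 j| -> derivable g s 1 /\ `|'D_1 g s - 'D_(e_ j) f x| <= e.
  move=> /Hs/H -/(_ j).
  have E : (fun r : R => r^-1 *: (g (r *: 1 + s) - g s)) =
     (fun r : R => r^-1 *: (f (r *: e_ j + (s *: e_ j + (hm m + x)))
                             - f (s *: e_ j + (hm m + x)))).
    by apply/funext => r; rewrite /g scalerDl scaler1 -addrA.
  by rewrite /derivable /derive /= E.
have := mean_value_bound dg; rewrite /g scale0r add0r => mv.
set a := f _; set b := f _; set S := \sum_(_ < n | _) _.
have -> : a - b - (h 0 j * 'D_(e_ j) f x + S) =
   (a - f (hm m + x) - h 0 j * 'D_(e_ j) f x) + (f (hm m + x) - b - S).
  by ring.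
apply: le_trans (ler_normD _ _) _; rewrite -natr1 !mulrDl mul1r [leRHS]addrC.
apply: lerD; last exact: IH (ltnW mn).
have -> : a = f (h 0 j *: e_ j + (hm m + x)) by rewrite /a addrA.
apply: le_trans mv _; apply: ler_wpM2l => //.
exact: coord_le_norm.
Qed.

Lemma partial_form_continuous f x : continuous (partial_form f x).
Proof.
move=> y; apply: differentiable_continuous.
have -> : (partial_form f x : _ -> _) =
    \sum_(j < n) (('D_(e_ j) f x) *: (fun v : 'rV[R]_n => v 0 j : R)).
  apply/funext => v; rewrite fct_sumE; apply: eq_bigr => j _.
  by rewrite [RHS]/GRing.scale /= mulrC.
by apply: differentiable_sum => j; apply: differentiableZ; exact: differentiable_coord.
Qed.

Lemma partials_differentiable f x :
  (forall j, \forall y \near x, derivable f y (e_ j)) ->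
  (forall j, {for x, continuous ('D_(e_ j) f)}) ->
  differentiable f x.
Proof.
move=> df cf.
apply: (@differentiable_approx _ _ _ (partial_form f x)).
  exact: partial_form_continuous.
move=> e e0.
pose e' := e / n.+1%:R.
have e'0 : 0 < e' by rewrite divr_gt0.
have Hj j : \forall y \near x, derivable f y (e_ j) /\
    `|'D_(e_ j) f y - 'D_(e_ j) f x| <= e'.
  near=> y; split; first by near: y; exact: df.
  rewrite distrC; near: y.
  by have /cvgrPdist_le/(_ _ e'0) := cf j.
have := filter_forall (nbhs_filter x) Hj.
move=> /nbhs_ballP; case=> d /= d0 Hd.
near=> h.
apply: le_trans (@partial_form_bound f x d e' d0 (ltW e'0) _ h _) _.
- move=> j y yx; have := Hd y; rewrite -ball_normE /= distrC => /(_ yx); exact.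
- near: h; apply/nbhs_ballP; exists d => // h; rewrite -ball_normE /= sub0r normrN; exact.
- apply: ler_wpM2r => //; rewrite /e' mulrCA ler_piMr ?(ltW e0) //.
  by rewrite ler_pdivrMr // mul1r ler_nat.
Unshelve. all: by end_near. Qed.

Lemma derive_partials f x v : differentiable f x ->
  'D_v f x = \sum_(j < n) v 0 j * 'D_(e_ j) f x.
Proof.
move=> df; rewrite (deriveE _ df) [in LHS](row_sum_delta v) linear_sum.
by apply: eq_bigr => j _; rewrite linearZ /= -deriveE.
Qed.

(** [Ck] speaks of directional derivatives only. Their continuity is what yields
    a differential, and with it linearity in the direction and the chain rule. *)
Lemma Ck_differentiable k (U : set 'rV[R]_n) f x : open U -> U x ->
  Ck k.+1 U f -> differentiable f x.
Proof.
move=> oU Ux /= [_ H]; apply: partials_differentiable => j.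
  have [dj _] := H (e_ j); near=> y; apply: dj; near: y; exact: open_nbhs_nbhs.
have [_ ] := H (e_ j); case: k {H} => [|k] /= [+ _]; exact.
Unshelve. all: by end_near. Qed.

Section Chain.
Context {V : normedModType R}.
Implicit Types (g : V -> 'rV[R]_n).

(** Only a directional derivative of g is available, so the chain rule is applied
    to the restriction of g to the line through x in the direction v. *)
Lemma is_derive_comp f g (x v : V) : differentiable f (g x) -> derivable g x v ->
  is_derive x v (f \o g) ('D_('D_v g x) f (g x)).
Proof.
move=> df dg.
pose h := fun t : R => g (t *: v + x).
have h0 : h 0 = g x by rewrite /h scale0r add0r.
have dh : differentiable h 0.
  by apply/derivable1_diffP; move/derivable1P: dg.
have dfh : differentiable (f \o h) 0 by apply: differentiable_comp => //; rewrite h0.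
have E (W : normedModType R) (F : V -> W) :
    'D_1 (fun t : R => F (t *: v + x)) 0 = 'D_v F x.
  rewrite /derive.
  set g1 := fun h => h^-1 *: _; set g2 := fun h => h^-1 *: _; suff -> : g1 = g2 by [].
  by apply/funext => r; rewrite /g1 /g2 /= addr0 scale0r add0r [_%:A]mulr1.
apply: DeriveDef.
  by apply/derivable1P; exact: diff_derivable dfh.
have dfh0 : differentiable f (h 0) by rewrite h0.
rewrite -[LHS]E -[in LHS]/(f \o h) (deriveE _ dfh) (diff_comp dh dfh0) /=.
by rewrite -(deriveE _ dh) h0 (E _ g) (deriveE _ df).
Qed.

(** By the chain rule a derivative of the composite is a sum of products of a
    derivative of g and a partial derivative of f composed with g: both factors
    are one order less differentiable, and induction applies. *)
Lemma Ck_comp_scalar k (U : set V) (O : set 'rV[R]_n) f g : open U -> open O ->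
  (forall x : V, U x -> O (g x)) -> Ck k U g -> Ck k O f -> Ck k U (f \o g).
Proof.
move=> oU oO UO.
elim: k f => [|k IH] f Cg Cf.
  move: Cg Cf => [cg _] [cf _]; split=> // x Ux.
  by apply: continuous_comp; [exact: cg|apply/cf/UO].
have Cg' := Ck_pred Cg.
have df (x : V) : U x -> differentiable f (g x).
  by move=> Ux; apply: Ck_differentiable oO _ Cf; exact: UO.
move: (Cg) (Cf) => /= [cg dg] [cf dfC].
split; first by move=> x Ux; apply: continuous_comp; [exact: cg|apply/cf/UO].
move=> v; have [dgv Cgv] := dg v.
split; first by move=> x Ux; have [] := is_derive_comp (df x Ux) (dgv x Ux).
have C j : Ck k U (fun x : V => ('D_v g x) 0 j * ('D_(e_ j) f (g x))).
  apply: Ck_mul => //; first by move/(Ck_rV _ _ oU): Cgv; exact.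
  by apply: (IH ('D_(e_ j) f)) => //; have [_] := dfC (e_ j).
apply: Ck_eq (@Ck_sum _ _ _ (index_enum 'I_n) _ _ _ oU C) => // x /set_mem Ux.
have [_ ->] := is_derive_comp (df x Ux) (dgv x Ux).
by rewrite derive_partials //; exact: df.
Qed.

Lemma Ck_comp k p (U : set V) (O : set 'rV[R]_n) (f : 'rV[R]_n -> 'rV[R]_p) g :
  open U -> open O ->
  (forall x : V, U x -> O (g x)) -> Ck k U g -> Ck k O f -> Ck k U (f \o g).
Proof.
move=> oU oO UO Cg /(Ck_rV _ _ oO) Cf; apply/(Ck_rV _ _ oU) => j.
exact: (@Ck_comp_scalar _ _ _ (fun y => f y 0 j) g oU oO UO Cg (Cf j)).
Qed.

End Chain.
End Differentiability.

(** * Symmetry of second derivatives *)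

Section Schwarz.
Context {R : realType} {V : normedModType R}.
Implicit Types (f : V -> R) (x u v w z : V).

Lemma line_mean_value f z w (r : R) : 0 < r ->
  (forall s, 0 <= s <= r -> derivable f (s *: w + z) w) ->
  exists2 s, 0 <= s <= r & f (r *: w + z) - f z = 'D_w f (s *: w + z) * r.
Proof.
move=> r0 H; pose g s := f (s *: w + z).
have E s : (fun h : R => h^-1 *: (g (h *: 1 + s) - g s)) =
     (fun h : R => h^-1 *: (f (h *: w + (s *: w + z)) - f (s *: w + z))).
  by apply/funext => h; rewrite /g scalerDl [_%:A]mulr1 addrA.
have dg s : 0 <= s <= r -> is_derive s 1 g ('D_w f (s *: w + z)).
  move=> /H dfs; apply: DeriveDef.
    by move: dfs; rewrite /derivable -E.
  by rewrite /derive E.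
have [s| |s] := @MVT_segment R g (fun s => 'D_w f (s *: w + z)) 0 r (ltW r0).
- by rewrite in_itv /= => /andP[/ltW s0 /ltW sr]; apply: dg; rewrite s0 sr.
- apply: derivable_within_continuous => s; rewrite in_itv /= => /dg [] //.
rewrite in_itv /= subr0 /g scale0r add0r => s0r e.
by exists s.
Qed.

(** Two applications of the mean value theorem, first along u to the increment of
    f along v, then along v. The left-hand side is symmetric in u and v, and this
    symmetry is the reason for the equality of mixed derivatives. *)
Lemma second_difference f (x u v : V) (r d : R) : 0 < r -> r * (`|u| + `|v|) < d ->
  (forall y, `|y - x| < d -> derivable f y u /\ derivable ('D_u f) y v) ->
  exists2 y, `|y - x| < d &
    f (r *: u + (r *: v + x)) - f (r *: u + x) - (f (r *: v + x) - f x)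
      = 'D_v ('D_u f) y * (r * r).
Proof.
move=> r0 rd H.
have near_x s t : 0 <= s <= r -> 0 <= t <= r -> `|s *: u + (t *: v + x) - x| < d.
  move=> /andP[s0 sr] /andP[t0 tr]; rewrite addrA addrK; apply: le_lt_trans rd.
  rewrite (le_trans (ler_normD _ _)) // !normrZ mulrDr !ger0_norm //.
  by rewrite lerD // ler_wpM2r.
have rr : 0 <= r <= r by rewrite lexx ltW.
have r00 : 0 <= (0:R) <= r by rewrite lexx ltW.
pose F y := f (r *: v + y) - f y.
have dF s : 0 <= s <= r ->
    is_derive (s *: u + x) u F ('D_u f (s *: u + (r *: v + x)) - 'D_u f (s *: u + x)).
  move=> sr.
  have d1 : derivable f (s *: u + (r *: v + x)) u by exact: (H _ (near_x _ _ sr rr)).1.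
  have d2 : derivable f (s *: u + x) u.
    by have := near_x _ _ sr r00; rewrite scale0r add0r => /H [].
  have E : (fun h : R => h^-1 *: (f (r *: v + (h *: u + (s *: u + x)))
                           - f (r *: v + (s *: u + x)))) =
     (fun h : R => h^-1 *: (f (h *: u + (s *: u + (r *: v + x)))
                           - f (s *: u + (r *: v + x)))).
    apply/funext => h; congr (_ *: (f _ - f _)); last by rewrite addrCA.
    by rewrite addrCA; congr (_ + _); rewrite addrCA.
  apply: is_deriveB; last exact: DeriveDef.
  by apply: DeriveDef; rewrite /derivable /derive /= E.
have [s sr] := @line_mean_value F x u r r0 (fun s sr => @ex_derive _ _ _ _ _ _ _ (dF s sr)).
rewrite (@derive_val _ _ _ _ _ _ _ (dF s sr)) {1 2}/F => e1.
have [t|t tr] := @line_mean_value ('D_u f) (s *: u + x) v r r0.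
  move=> tr; rewrite addrCA; exact: (H _ (near_x _ _ sr tr)).2.
rewrite [X in 'D_u f X - _]addrCA => e2.
exists (t *: v + (s *: u + x)); first by rewrite addrCA near_x.
by rewrite mulrA -e2 -e1; congr (f _ - _ - _); rewrite addrCA.
Qed.

(** The second difference of f in the directions u and v equals both mixed
    derivatives at points near x, times the same factor; their continuity at x
    concludes. *)
Lemma derive_comm f (U : set V) x u v : open U -> U x -> Ck 2 U f ->
  'D_u ('D_v f) x = 'D_v ('D_u f) x.
Proof.
move=> oU Ux /= [_ H].
have [du [cu cdu]] := H u; have [dv [cv cdv]] := H v.
have [duv [cuv _]] := cdu v; have [dvu [cvu _]] := cdv u.
apply/eqP; rewrite -subr_eq0 -normr_le0; apply/ler_addgt0Pr => e e0; rewrite add0r.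
have fin (a b p q : R) : `|a - p| <= e / 2 -> `|b - q| <= e / 2 -> q = p -> `|a - b| <= e.
  move=> ap bq qp; rewrite -(subrKA p) (le_trans (ler_normD _ _)) // [leRHS]splitr.
  by apply: lerD => //; rewrite -qp distrC.
have e20 : 0 < e / 2 by rewrite divr_gt0.
have Hvu : \forall y \near x, `|'D_u ('D_v f) x - 'D_u ('D_v f) y| <= e / 2.
  by have /cvgrPdist_le := cvu x Ux; apply.
have Huv : \forall y \near x, `|'D_v ('D_u f) x - 'D_v ('D_u f) y| <= e / 2.
  by have /cvgrPdist_le := cuv x Ux; apply.
have HU : \forall y \near x, U y by exact: open_nbhs_nbhs.
have /nbhs_ballP[d /= d0 Hd] : nbhs x (U `&` ((fun y => `|'D_u ('D_v f) x - 'D_u ('D_v f) y| <= e / 2)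
    `&` (fun y => `|'D_v ('D_u f) x - 'D_v ('D_u f) y| <= e / 2))).
  by apply: filterI HU _; exact: filterI Hvu Huv.
have {}Hd y : `|y - x| < d -> [/\ U y, `|'D_u ('D_v f) x - 'D_u ('D_v f) y| <= e / 2 &
     `|'D_v ('D_u f) x - 'D_v ('D_u f) y| <= e / 2].
  move=> yx; have [] := Hd y; first by rewrite -ball_normE /= distrC.
  by move=> ? [].
pose M := `|u| + `|v| + 1.
have M0 : 0 < M by rewrite ltr_wpDl // addr_ge0.
pose r := d / M.
have r0 : 0 < r by rewrite divr_gt0.
have rd : r * (`|u| + `|v|) < d.
  by rewrite /r mulrAC -mulrA gtr_pMr // ltr_pdivrMr // mul1r ltrDl.
have rd' : r * (`|v| + `|u|) < d by rewrite [`|v| + _]addrC.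
have [y yx e1] := @second_difference f x u v r d r0 rd
  (fun y yx => let: And3 Uy _ _ := Hd y yx in conj (du y Uy) (duv y Uy)).
have [z zx e2] := @second_difference f x v u r d r0 rd'
  (fun y yx => let: And3 Uy _ _ := Hd y yx in conj (dv y Uy) (dvu y Uy)).
have e3 : 'D_v ('D_u f) y = 'D_u ('D_v f) z.
  have rr0 : r * r != 0 by rewrite mulf_neq0 // gt_eqF.
  have K (a b c d' : R) : a - b - (c - d') = a - c - (b - d') by ring.
  apply: (mulIf rr0); apply: etrans (esym e1) (etrans (K _ _ _ _) (etrans _ e2)).
  by rewrite addrCA.
have [_ _ Hy] := Hd y yx; have [_ Hz _] := Hd z zx.
exact: fin Hz Hy e3.
Qed.

End Schwarz.

(** * Functions of one real variable *)

Section OneVariable.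
Context {R : realType}.

Definition coord_map n (j : 'I_n) (v : 'rV[R]_n) : R := v 0 j.

Lemma coord_map_linear n (j : 'I_n) : linear (coord_map j).
Proof. by move=> a u v; rewrite /coord_map !mxE. Qed.

HB.instance Definition _ n j :=
  GRing.isLinear.Build R 'rV[R]_n R _ (@coord_map n j) (@coord_map_linear n j).

Lemma coord_map_continuous n (j : 'I_n) : continuous (coord_map j).
Proof. exact: coord_continuous. Qed.

Definition row_of_real (a : R) : 'rV[R]_1 := const_mx a.

Lemma row_of_real_linear : linear row_of_real.
Proof. by move=> a u v; apply/rowP => i; rewrite !mxE. Qed.

HB.instance Definition _ :=
  GRing.isLinear.Build R R 'rV[R]_1 _ row_of_real row_of_real_linear.

Lemma row_of_real_continuous : continuous row_of_real.
Proof.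
move=> a; apply: continuous_rV => j.
by rewrite (_ : (fun=> _) = id); [exact: cvg_id|apply/funext => b; rewrite mxE].
Qed.

(** The line is identified with the row vectors of length 1, which reduces the
    claim to the composition of maps of several variables. *)
Lemma Ck_comp1_scalar (V : normedModType R) k (U : set V) (O : set R) (f : R -> R)
    (g : V -> R) : open U -> open O -> (forall x, U x -> O (g x)) ->
  Ck k U g -> Ck k O f -> Ck k U (f \o g).
Proof.
move=> oU oO UO Cg Cf.
have := @Ck_comp_scalar R 1 V k U (coord_map 0 @^-1` O) (f \o coord_map 0) (row_of_real \o g).
rewrite (_ : (f \o coord_map 0) \o (row_of_real \o g) = f \o g); last first.
  by apply/funext => x; rewrite /= /coord_map mxE.
apply => //.
- by apply: open_comp => // x _; exact: coord_map_continuous.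
- by move=> x Ux /=; rewrite /coord_map mxE; exact: UO.
- apply/(Ck_rV _ _ oU) => j; rewrite (_ : (fun=> _) = g) //.
  by apply/funext => x; rewrite mxE.
- exact: Ck_comp_linear (@coord_map_continuous _ _) Cf.
Qed.

Lemma Ck_comp1 (V : normedModType R) k p (U : set V) (O : set R) (f : R -> 'rV[R]_p)
    (g : V -> R) : open U -> open O -> (forall x, U x -> O (g x)) ->
  Ck k U g -> Ck k O f -> Ck k U (f \o g).
Proof.
move=> oU oO UO Cg /(Ck_rV _ _ oO) Cf; apply/(Ck_rV _ _ oU) => j.
exact: (@Ck_comp1_scalar _ _ _ _ (fun y => f y 0 j) g oU oO UO Cg (Cf j)).
Qed.

Lemma is_derive_scale (f : R -> R) (s v l : R) :
  is_derive s 1 f l -> is_derive s v f (v * l).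
Proof.
move=> [df dl]; have df' : differentiable f s by apply/derivable1_diffP.
apply: DeriveDef; first exact: diff_derivable.
have -> : 'D_v f s = 'd f s (v *: (1 : R)) by rewrite deriveE // [_ *: _]mulr1.
by rewrite linearZ -dl deriveE.
Qed.

(** Bootstrap: a solution of h' = F(h) that is k times differentiable has a
    derivative that is k times differentiable. *)
Lemma Ck_ode k (J O : set R) (F h : R -> R) : open J -> open O ->
  (forall s, J s -> O (h s)) -> (forall s, J s -> is_derive s 1 h (F (h s))) ->
  Ck k O F -> Ck k J h.
Proof.
move=> oJ oO JO dh; have ch s : J s -> {for s, continuous h}.
  move=> Js; apply: differentiable_continuous; apply/derivable1_diffP.
  by case: (dh s Js).
elim: k => [|k IH] CF; first by split.
have CF' := Ck_pred CF.
split=> // v; split=> [s /dh/(is_derive_scale v) [] //|].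
have C : Ck k J (fun s => v * F (h s)).
  apply: Ck_mul => //; first exact: Ck_cst.
  by apply: (@Ck_comp1_scalar _ _ _ O F h) => //; exact: IH.
apply: Ck_eq C => // s /set_mem /dh/(is_derive_scale v) H.
by rewrite derive_val.
Qed.

End OneVariable.

Section Intervals.
Context {R : realType}.
Implicit Types (J A : set R).

Lemma open_right J t : open J -> J t -> exists2 b, t < b & J b.
Proof.
move=> oJ Jt; have : nbhs t J by exact: open_nbhs_nbhs.
move=> /nbhs_ballP[r /= r0 H]; exists (t + r / 2); first by rewrite ltrDl divr_gt0.
apply: H; rewrite /ball /= opprD addNKr normrN gtr0_norm ?divr_gt0 //.
by rewrite ltr_pdivrMr // ltr_pMr // ltr1n.
Qed.

Lemma open_left J t : open J -> J t -> exists2 a, a < t & J a.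
Proof.
move=> oJ Jt; have : nbhs t J by exact: open_nbhs_nbhs.
move=> /nbhs_ballP[r /= r0 H]; exists (t - r / 2); first by rewrite ltrBlDr ltrDl divr_gt0.
apply: H; rewrite /ball /= opprB addrCA subrr addr0 gtr0_norm ?divr_gt0 //.
by rewrite ltr_pdivrMr // ltr_pMr // ltr1n.
Qed.

(** The connected component of t0 in A, in a form that avoids connectedness: the
    points that are joined to t0 by a segment contained in A. *)
Definition interval_component A t0 : set R :=
  [set t | forall s, t0 <= s <= t \/ t <= s <= t0 -> A s].

Variables (A : set R) (t0 : R).
Local Notation J := (interval_component A t0).

Lemma interval_component_sub : J `<=` A.
Proof.
by move=> t; apply; have [tt|/ltW tt] := leP t t0; [right|left]; rewrite ?tt ?lexx.
Qed.

Lemma interval_component_self : A t0 -> J t0.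
Proof.
by move=> At0 s [] /andP[s1 s2]; have -> // : s = t0; apply/eqP; rewrite eq_le s1 s2.
Qed.

Lemma interval_component_interval : is_interval J.
Proof.
move=> x y Jx Jy z /andP[xz zy] s [] /andP[s1 s2].
  by apply: Jy; left; rewrite s1 (le_trans s2).
by apply: Jx; right; rewrite s2 (le_trans xz).
Qed.

Lemma interval_component_open : open A -> open J.
Proof.
move=> oA; rewrite openE => t Jt.
have : nbhs t A by apply: open_nbhs_nbhs; split=> //; exact: interval_component_sub.
move=> /nbhs_ballP[r /= r0 H]; apply/nbhs_ballP; exists r => //= t'.
rewrite /ball /= ; rewrite ltr_distlC => /andP[t1 t2] s ss.
have B : t - r < s < t + r -> A s.
  by move=> tsr; apply: H; rewrite /ball /= ltr_distlC.
have [st|ts] := leP s t; have [st0|ts0] := leP s t0.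
- case: ss => /andP[s1 s2].
    by apply: Jt; left; rewrite st andbT.
  by apply: B; apply/andP; split; lra.
- case: ss => /andP[s1 s2].
    by apply: Jt; left; rewrite st andbT ltW.
  by exfalso; lra.
- case: ss => /andP[s1 s2].
    by apply: B; apply/andP; split; lra.
  by apply: Jt; right; rewrite st0 andbT ltW.
- case: ss => /andP[s1 s2]; last by exfalso; lra.
  by apply: B; apply/andP; split; lra.
Qed.

End Intervals.

(** * Endpoints of curves and of their pieces in an open set *)

Section Endpoints.
Context {R : realType} {T : topologicalType}.
Hypothesis hT : hausdorff_space T.
Implicit Types (I : set R) (c : R -> T) (O : set T) (p : T).

(** If J does not reach the upper end of I, its supremum be lies in I and outside
    J. By continuity c be is the limit p of c along J, which lies in O; then be
    would belong to J. *)
Lemma no_upper_limit I c O t0 p : is_interval I ->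
  (forall t, I t -> {for t, continuous c}) -> open I -> open O -> O p ->
  let J := interval_component (I `&` c @^-1` O) t0 in
  J t0 ->
  (forall W, nbhs p W -> exists2 t1, J t1 & forall t, J t -> t1 <= t -> W (c t)) ->
  forall W, nbhs p W -> exists2 t1, I t1 & forall t, I t -> t1 <= t -> W (c t).
Proof.
move=> iI cc oI oO Op J Jt0 H.
have JI t : J t -> I t by move=> /interval_component_sub [].
have iJ : is_interval J by exact: interval_component_interval.
have oJ : open J.
  apply: interval_component_open; rewrite openE => t [It Ot].
  apply: filterI; first exact: open_nbhs_nbhs.
  by apply: (cc t It); exact: open_nbhs_nbhs.
have [cof|] := pselect (forall b, I b -> t0 <= b -> J b).
  move=> W /H [t1 Jt1 Wt1]; exists t1; first exact: JI.
  move=> t It t1t; apply: Wt1 => //.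
  have [tt|tt] := leP t0 t; first exact: cof.
  by apply: (iJ t1 t0) => //; rewrite t1t ltW.
move=> /existsNP[b /not_implyP[Ib /not_implyP[t0b nJb]]].
exfalso.
have ub t : J t -> t < b.
  move=> Jt; rewrite ltNge; apply/negP => bt; apply: nJb.
  by apply: (iJ t0 t) => //; rewrite t0b.
have hsJ : has_sup J by split; [exists t0|exists b => t /ub/ltW].
pose be := sup J.
have Jlt t : J t -> t < be.
  move=> Jt; have [b' tb' Jb'] := open_right oJ Jt.
  by apply: lt_le_trans tb' _; exact: (sup_upper_bound hsJ).
have ltJ t : t0 <= t -> t < be -> J t.
  move=> t0t tb; have be_t : 0 < be - t by rewrite subr_gt0.
  have [t' Jt'] := sup_adherent be_t hsJ; rewrite -/be opprB addrCA subrr addr0 => tt'.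
  by apply: (iJ t0 t') => //; rewrite t0t ltW.
have t0be : t0 < be := Jlt _ Jt0.
have beb : be <= b by apply: ge_sup; [exists t0|move=> t /ub/ltW].
have Ibe : I be by apply: (iI t0 b) => //; [exact: JI|rewrite beb ltW].
have cbe : p = c be.
  apply: hT => A B /H [t1 Jt1 At1] nB.
  have : nbhs be (c @^-1` B) by exact: (cc be Ibe).
  move=> /nbhs_ballP[r /= r0 Br].
  pose t := Num.max (Num.max t0 t1) (be - r / 2).
  have tbe : t < be.
    by rewrite !gt_max t0be (Jlt _ Jt1) /= ltrBlDr ltrDl divr_gt0.
  have Jt : J t by apply: ltJ => //; rewrite !le_max lexx.
  exists (c t); split; first by apply: At1 => //; rewrite !le_max lexx orbT.
  apply: Br; rewrite /ball /= gtr0_norm ?subr_gt0 //.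
  have : be - r / 2 <= t by rewrite !le_max lexx orbT.
  by move=> h; have : 0 < r / 2; [rewrite divr_gt0|lra].
have : J be.
  move=> s [] /andP[s1 s2]; last by exfalso; lra.
  move: s2; rewrite le_eqVlt => /orP[/eqP ->|sbe].
    by split => //=; rewrite -cbe.
  by apply: interval_component_sub; exact: ltJ.
by move/Jlt; rewrite ltxx.
Qed.

(** Time reversal of [no_upper_limit]. *)
Lemma no_lower_limit I c O t0 p : is_interval I ->
  (forall t, I t -> {for t, continuous c}) -> open I -> open O -> O p ->
  let J := interval_component (I `&` c @^-1` O) t0 in
  J t0 ->
  (forall W, nbhs p W -> exists2 t1, J t1 & forall t, J t -> t <= t1 -> W (c t)) ->
  forall W, nbhs p W -> exists2 t1, I t1 & forall t, I t -> t <= t1 -> W (c t).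
Proof.
move=> iI cc oI oO Op J Jt0 H W nW.
pose I' := -%R @^-1` I; pose c' := c \o -%R.
have JE t : interval_component (I' `&` c' @^-1` O) (- t0) t <-> J (- t).
  split=> K s ss.
    have [] := K (- s); last by rewrite /I' /c' /= opprK.
    by rewrite lerN2 lerNl lerNr; case: ss; [right|left]; lra.
  by apply: (K (- s)); case: ss; [right|left]; lra.
have [|||||t1 It1 Wt1] := @no_upper_limit I' c' O (- t0) p _ _ _ oO Op _ _ W nW.
- by move=> x y Ix Iy z xzy; apply: (iI (- y) (- x)) => //; lra.
- by move=> t It; apply: continuous_comp; [exact: opp_continuous|exact: cc].
- by apply: open_comp => // x _; exact: opp_continuous.
- by apply/JE; rewrite opprK.
- move=> W' /H [t1 Jt1 Wt1]; exists (- t1); first by apply/JE; rewrite opprK.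
  by move=> t /JE Jt tt; apply: Wt1 => //; lra.
by exists (- t1) => // t It tt; rewrite -[t]opprK; apply: Wt1; [rewrite /I' /= opprK|lra].
Qed.

End Endpoints.

(** * Primitives and inverses of increasing functions *)

Section Antiderivative.
Context {R : realType}.
Notation mu := (@lebesgue_measure R).

(** The integral of f from t0, written with two half-open intervals so that the
    same formula has the right sign on both sides of t0. *)
Lemma antiderivative_exists (f : R -> R) (J : set R) (t0 : R) :
  open J -> is_interval J -> J t0 -> (forall t, J t -> {for t, continuous f}) ->
  exists h : R -> R, forall t, J t -> is_derive t 1 h (f t).
Proof.
move=> oJ iJ Jt0 cf.
exists (fun s => (\int[mu]_(x in `]t0, s]) f x - \int[mu]_(x in `]s, t0]) f x)%R).
move=> t Jt.
have [a [am Ja]] : exists a, a < Num.min t t0 /\ J a.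
  have Jm : J (Num.min t t0) by rewrite /Num.min; case: ifP.
  by have [a] := open_left oJ Jm; exists a.
have [b [bm Jb]] : exists b, Num.max t t0 < b /\ J b.
  have Jm : J (Num.max t t0) by rewrite /Num.max; case: ifP.
  by have [b] := open_right oJ Jm; exists b.
move: am bm; rewrite lt_min gt_max => /andP[at_ at0] /andP[tb t0b].
have cab x : a <= x <= b -> {for x, continuous f} by move=> xab; apply: cf; exact: (iJ a b).
have intf x y : a <= x -> y <= b -> mu.-integrable `[x, y] (EFin \o f).
  move=> ax yb; apply: continuous_compact_integrable; first exact: segment_compact.
  apply: continuous_in_subspaceT => z /set_mem /=; rewrite in_itv /= => /andP[xz zy].
  by apply: cab; rewrite (le_trans ax) // (le_trans zy).
pose F s := (\int[mu]_(x in `[a, s]) f x)%R.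
have dF : is_derive t 1 F (f t).
  have [dF eF] := @continuous_FTC1_closed R f a t b tb (intf a b (lexx _) (lexx _)) at_
    (cab _ (introT andP (conj (ltW at_) (ltW tb)))).
  by apply: DeriveDef; [exact: dF | rewrite -derive1E; exact: eF].
have FB x y : a <= x -> x <= y -> y <= b -> F y - F x = (\int[mu]_(z in `]x, y]) f z)%R.
  move=> ax xy yb; rewrite /F Rintegral_itvB ?bnd_simp //; exact: intf.
have empty x y : y <= x -> (\int[mu]_(z in `]x, y]) f z)%R = 0.
  by move=> yx; rewrite set_itv_ge ?Rintegral_set0 // bnd_simp -leNgt.
have H : is_derive t 1 (fun s => F s - F t0) (f t).
  by rewrite -[f t]subr0; apply: is_deriveB.
apply: near_eq_is_derive H.
have : nbhs t `]a, b[%classic.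
  by apply: near_in_itvoo; rewrite in_itv /= at_ tb.
apply: filterS => s; rewrite /= in_itv /= => /andP[as_ sb].
have [st|/ltW ts] := leP s t0.
  rewrite (empty t0 s st) sub0r -FB ?opprB // ltW //.
by rewrite (empty s t0 ts) subr0 -FB // ltW.
Qed.

(** The mean value theorem makes h strictly increasing on J. Its inverse k is
    continuous, so k takes values in J near h t; hence the image of J is open. *)
Lemma increasing_inverse (f h : R -> R) (J : set R) :
  open J -> is_interval J -> (forall t, J t -> is_derive t 1 h (f t)) ->
  (forall t, J t -> 0 < f t) ->
  exists k : R -> R, [/\ open (h @` J), is_interval (h @` J),
     (forall t, J t -> k (h t) = t),
     (forall t t', J t -> J t' -> (h t < h t') = (t < t')) &
     forall t, J t -> is_derive (h t) 1 k (f t)^-1].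
Proof.
move=> oJ iJ dh f0.
have ch t : J t -> {for t, continuous h}.
  move=> Jt; apply: differentiable_continuous; apply/derivable1_diffP.
  by case: (dh t Jt).
have hlt t t' : J t -> J t' -> t < t' -> h t < h t'.
  move=> Jt Jt' tt'.
  have Jin s : t <= s <= t' -> J s by exact: iJ.
  have d s : s \in `]t, t'[%R -> is_derive s 1 h (f s).
    by rewrite in_itv /= => /andP[/ltW a /ltW b]; apply/dh/Jin; rewrite a b.
  have c : {within `[t, t'], continuous h}.
    apply: continuous_in_subspaceT => z /set_mem /=; rewrite in_itv /= => zz.
    exact/ch/Jin.
  have [s] := MVT tt' d c; rewrite in_itv /= => /andP[/ltW a /ltW b] e.
  by rewrite -subr_gt0 e mulr_gt0 ?subr_gt0 //; apply/f0/Jin; rewrite a b.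
have hlt' t t' : J t -> J t' -> (h t < h t') = (t < t').
  move=> Jt Jt'; apply/idP/idP; last exact: hlt.
  apply: contraTT; rewrite -!leNgt le_eqVlt => /orP[/eqP ->//|tt].
  by apply/ltW/hlt.
have hinj t t' : J t -> J t' -> h t = h t' -> t = t'.
  move=> Jt Jt' e; have := hlt' t t' Jt Jt'; have := hlt' t' t Jt' Jt.
  by rewrite e ltxx; case: ltgtP.
pose k s := get [set t | J t /\ h t = s].
have kh t : J t -> k (h t) = t.
  move=> Jt; have [] : [set t' | J t' /\ h t' = h t] (k (h t)) by apply: getPex; exists t.
  by move=> Jk /hinj; apply.
have nJ t : J t -> nbhs t J by move=> Jt; exact: open_nbhs_nbhs.
have dk t : J t -> is_derive (h t) 1 k (f t)^-1.
  move=> Jt; apply: is_derive_inverse.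
  - by apply: filterS (nJ t Jt) => s; exact: kh.
  - by apply: filterS (nJ t Jt) => s; exact: ch.
  - exact: dh.
  - by rewrite gt_eqF // f0.
exists k; split=> //.
- rewrite openE => _ [t Jt <-].
  have kK : {near h t, cancel k h}.
    apply: near_continuous_can_sym; apply: filterS (nJ t Jt) => s; [exact: ch|exact: kh].
  have ck : {for h t, continuous k}.
    apply: differentiable_continuous; apply/derivable1_diffP.
    by case: (dk t Jt).
  have : nbhs (h t) (k @^-1` J) by apply: ck; rewrite kh //; exact: nJ.
  move=> nk; apply: filterS (filterI nk kK) => s [/= Jk ks].
  by exists (k s).
- apply/connected_intervalP; apply: connected_continuous_connected.
    exact/connected_intervalP.
  by apply: continuous_in_subspaceT => t /set_mem Jt; exact: ch.
Qed.

End Antiderivative.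

(** * Derivatives of matrix-valued maps *)

Section MatrixDerivatives.
Context {R : realType} {V : normedModType R}.

Lemma is_derive_mxP m n (M : V -> 'M[R]_(m, n)) (dM : 'M[R]_(m, n)) x v :
  is_derive x v M dM <-> forall i j, is_derive x v (fun y => M y i j) (dM i j).
Proof.
split=> [[dMx <-] i j|H].
  by apply: DeriveDef; [move/derivable_mxP: dMx; exact | rewrite derive_mx // mxE].
have dMx : derivable M x v by apply/derivable_mxP => i j; case: (H i j).
by apply: DeriveDef => //; apply/matrixP => i j; rewrite derive_mx // mxE; case: (H i j).
Qed.

Lemma is_derive_mulmx m n p (A : V -> 'M[R]_(m, n)) (B : V -> 'M[R]_(n, p)) dA dB x v :
  is_derive x v A dA -> is_derive x v B dB ->
  is_derive x v (fun y => A y *m B y) (dA *m B x + A x *m dB).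
Proof.
move=> /is_derive_mxP HA /is_derive_mxP HB; apply/is_derive_mxP => i j.
have E : (fun y => (A y *m B y) i j) =
    \sum_(k < n) ((fun y => A y i k) * (fun y => B y k j)).
  by apply/funext => y; rewrite mxE fct_sumE.
rewrite E !mxE -big_split /=; apply: is_derive_sum => k.
apply: is_derive_eq (is_deriveM (HA i k) (HB k j)) _.
by rewrite /GRing.scale /= addrC [B x k j * _]mulrC.
Qed.

Lemma is_derive_trmx m n (A : V -> 'M[R]_(m, n)) dA x v :
  is_derive x v A dA -> is_derive x v (fun y => (A y)^T) dA^T.
Proof.
move=> /is_derive_mxP HA; apply/is_derive_mxP => i j; rewrite mxE.
by rewrite (_ : (fun y => _) = fun y => A y j i) //; apply/funext => y; rewrite mxE.
Qed.

Lemma is_derive_scalemx m n (a : V -> R) (A : V -> 'M[R]_(m, n)) da dA x v :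
  is_derive x v a da -> is_derive x v A dA ->
  is_derive x v (fun y => a y *: A y) (da *: A x + a x *: dA).
Proof.
move=> Ha /is_derive_mxP HA; apply/is_derive_mxP => i j.
rewrite (_ : (fun y => _) = a * (fun y => A y i j)); last first.
  by apply/funext => y; rewrite !mxE.
apply: is_derive_eq (is_deriveM Ha (HA i j)) _.
by rewrite !mxE /GRing.scale /= addrC [A x i j * _]mulrC.
Qed.

End MatrixDerivatives.

Section VectorCalculus.
Context {R : realType} {n : nat}.
Implicit Types (y w : 'rV[R]_n).

(** Differentiability of each entry is the form in which the scalar results above
    apply to maps with matrix values. *)
Definition entrywise_differentiable a b (f : 'rV[R]_n -> 'M[R]_(a, b)) y :=
  forall i j, differentiable (fun z => f z i j) y.

Lemma derive_linear_in_direction a b (f : 'rV[R]_n -> 'M[R]_(a, b)) y w :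
  entrywise_differentiable f y ->
  'D_w f y = \sum_(j < n) w 0 j *: 'D_(delta_mx 0 j) f y.
Proof.
move=> df; have dd u : derivable f y u.
  by apply/derivable_mxP => i j; exact: diff_derivable.
apply/matrixP => i k; rewrite derive_mx // mxE summxE derive_partials //.
by apply: eq_bigr => j _; rewrite !mxE derive_mx // mxE.
Qed.

Lemma is_derive_comp_mx (V : normedModType R) a b (f : 'rV[R]_n -> 'M[R]_(a, b))
    (g : V -> 'rV[R]_n) x v : entrywise_differentiable f (g x) -> derivable g x v ->
  is_derive x v (f \o g) ('D_('D_v g x) f (g x)).
Proof.
move=> df dg; apply/is_derive_mxP => i j.
have dd u : derivable f (g x) u.
  by apply/derivable_mxP => k l; exact: diff_derivable.
rewrite derive_mx // mxE.
exact: (@is_derive_comp _ _ _ (fun y => f y i j)).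
Qed.

(** Row j holds the derivative of phi along the j-th coordinate, so that the
    differential acts on row vectors by multiplication on the right. *)
Definition jacobian_mx p (phi : 'rV[R]_n -> 'rV[R]_p) y : 'M[R]_(n, p) :=
  \matrix_(j, a) 'D_(delta_mx 0 j) phi y 0 a.

Lemma derive_jacobian p (phi : 'rV[R]_n -> 'rV[R]_p) y w :
  entrywise_differentiable phi y -> 'D_w phi y = w *m jacobian_mx phi y.
Proof.
move=> df; rewrite derive_linear_in_direction //; apply/rowP => a.
by rewrite summxE !mxE; apply: eq_bigr => j _; rewrite !mxE.
Qed.

Lemma Ck_entrywise_differentiable p k (U : set 'rV[R]_n) (phi : 'rV[R]_n -> 'rV[R]_p) y :
  open U -> U y -> Ck k.+1 U phi -> entrywise_differentiable phi y.
Proof.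
move=> oU Uy /(Ck_rV _ _ oU) C i j; rewrite (ord1 i).
exact: Ck_differentiable oU Uy (C j).
Qed.

Lemma Ck_derivable (V W : normedModType R) k (U : set V) (f : V -> W) x v :
  U x -> Ck k.+1 U f -> derivable f x v.
Proof. by move=> Ux [_ /(_ v) [+ _]]; exact. Qed.

Lemma jacobian_entrywise_differentiable p (U : set 'rV[R]_n) (phi : 'rV[R]_n -> 'rV[R]_p) y :
  open U -> U y -> Ck 2 U phi -> entrywise_differentiable (jacobian_mx phi) y.
Proof.
move=> oU Uy C j a.
have -> : (fun z => jacobian_mx phi z j a) = fun z => 'D_(delta_mx 0 j) phi z 0 a.
  by apply/funext => z; rewrite mxE.
have [_ /(_ (delta_mx 0 j)) [_ C1]] := C.
exact: (@Ck_entrywise_differentiable _ 0 _ _ _ oU Uy C1 0 a).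
Qed.

(** Equality of mixed second derivatives, in the form needed below: the derivative
    of the Jacobian along w, at row j, is w applied to its derivative along the
    j-th coordinate. *)
Lemma jacobian_symmetric p (U : set 'rV[R]_n) (phi : 'rV[R]_n -> 'rV[R]_p) y w :
  open U -> U y -> Ck 2 U phi -> forall j a,
  'D_w (jacobian_mx phi) y j a = (w *m 'D_(delta_mx 0 j) (jacobian_mx phi) y) 0 a.
Proof.
move=> oU Uy C j a.
have dJ := jacobian_entrywise_differentiable oU Uy C.
have dd u : derivable (jacobian_mx phi) y u.
  by apply/derivable_mxP => k l; exact: diff_derivable.
have dE u k l : 'D_u (jacobian_mx phi) y k l = 'D_u (fun z => jacobian_mx phi z k l) y.
  by rewrite derive_mx // mxE.
rewrite derive_linear_in_direction // summxE [RHS]mxE; apply: eq_bigr => i _.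
have sE (c : R) (M : 'M[R]_(n, p)) k l : (c *: M) k l = c * M k l by rewrite mxE.
rewrite sE; congr (_ * _).
apply: etrans (dE (delta_mx 0 i) j a) _; apply: etrans _ (esym (dE (delta_mx 0 j) i a)).
have K (r s : 'I_n) : 'D_(delta_mx 0 r) (fun z => jacobian_mx phi z s a) y =
    'D_(delta_mx 0 r) ('D_(delta_mx 0 s) (fun z => phi z 0 a)) y.
  apply: near_eq_derive; near=> z; rewrite [LHS]mxE.
  have Uz : U z by near: z; exact: open_nbhs_nbhs.
  have dz : derivable phi z (delta_mx 0 s) by exact: (@Ck_derivable _ _ 1 _ _ _ _ Uz C).
  by rewrite (derive_mx dz) mxE.
apply: etrans (K i j) (etrans _ (esym (K j i))); apply: (@derive_comm R 'rV[R]_n (fun z => phi z 0 a : R) U y _ _ oU Uy).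
by move/(Ck_rV _ _ oU): C; exact.
Unshelve. all: by end_near. Qed.

(** * The Euler-Lagrange equation of a quadratic energy *)

(** For the energy q' H(q) q'^T / 2, the derivative of the momentum q' H(q) is the
    gradient of the energy in the position. Unlike the geodesic equation with its
    Christoffel symbols, this form is visibly independent of coordinates and does
    not mention the inverse of H. *)
Definition euler_lagrange (H : 'rV[R]_n -> 'M[R]_n) (q : R -> 'rV[R]_n) (t : R) : Prop :=
  forall p, is_derive t 1 (fun s => ('D_1 q s *m H (q s)) 0 p)
    (2^-1 * ('D_1 q t *m 'D_(delta_mx 0 p) H (q t) *m ('D_1 q t)^T) 0 0).

(** Invariance under a change of coordinates phi. With J the Jacobian of phi, the
    momentum of q for H = J G(phi) J^T is P J^T, where P is the momentum of
    phi o q for G. In its derivative, P (dJ/dt)^T matches the gradient of J in the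
    energy because mixed second derivatives of phi commute. *)
Lemma euler_lagrange_pullback (G H : 'rV[R]_n -> 'M[R]_n) (phi : 'rV[R]_n -> 'rV[R]_n)
    (q : R -> 'rV[R]_n) (U : set 'rV[R]_n) (I : set R) t :
  open U -> Ck 2 U phi -> open I -> I t -> (forall s, I s -> U (q s)) -> Ck 2 I q ->
  entrywise_differentiable G (phi (q t)) -> (forall y, (G y)^T = G y) ->
  (forall y, U y -> H y = jacobian_mx phi y *m G (phi y) *m (jacobian_mx phi y)^T) ->
  euler_lagrange G (phi \o q) t -> euler_lagrange H q t.
Proof.
move=> oU Cphi oI It IU Cq dG symG HE EL p.
set J := jacobian_mx phi.
have dphi y : U y -> entrywise_differentiable phi y.
  by move=> Uy; exact: (Ck_entrywise_differentiable oU Uy Cphi).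
have dJ := jacobian_entrywise_differentiable oU (IU _ It) Cphi.
have dq s : I s -> derivable q s 1 by move=> Is; exact: Ck_derivable Is Cq.
have velE s : I s -> 'D_1 (phi \o q) s = 'D_1 q s *m J (q s).
  move=> Is; have [_ ->] := is_derive_comp_mx (dphi _ (IU _ Is)) (dq _ Is).
  exact/derive_jacobian/dphi/IU.
set v : 'rV[R]_n := 'D_1 q t; set w : 'rV[R]_n := 'D_1 (phi \o q) t.
pose P s := 'D_1 (phi \o q) s *m G (phi (q s)).
pose dP : 'rV[R]_n := \row_a (2^-1 * (w *m 'D_(delta_mx 0 a) G (phi (q t)) *m w^T) 0 0).
have HP : is_derive t 1 P dP.
  by apply/is_derive_mxP => i a; rewrite (ord1 i) mxE; exact: EL.
have HJ : is_derive t 1 (J \o q) ('D_v J (q t)).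
  by apply: is_derive_comp_mx => //; exact: dq.
have H1 := is_derive_mulmx HP (is_derive_trmx HJ).
have E1 : \near t, P t *m (J (q t))^T = 'D_1 q t *m H (q t).
  near=> s; have Is : I s by near: s; exact: open_nbhs_nbhs.
  by rewrite /P velE // (HE _ (IU _ Is)) !mulmxA.
have /is_derive_mxP/(_ 0 p) H2 := near_eq_is_derive E1 H1.
apply: (is_derive_eq H2).
(* both sides are now compared through the product rule for J G(phi) J^T *)
have dGphi : is_derive (q t) (delta_mx 0 p) (G \o phi)
    ('D_('D_(delta_mx 0 p) phi (q t)) G (phi (q t))).
  by apply: is_derive_comp_mx => //; exact: Ck_derivable (IU _ It) Cphi.
have dJp : is_derive (q t) (delta_mx 0 p) J ('D_(delta_mx 0 p) J (q t)).
  by apply: derivableP; apply/derivable_mxP => k l; exact/diff_derivable/dJ.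
have H3 := is_derive_mulmx (is_derive_mulmx dJp dGphi) (is_derive_trmx dJp).
have E3 : \forall y \near q t, J y *m (G \o phi) y *m (J y)^T = H y.
  near=> y; rewrite HE //; near: y; apply: open_nbhs_nbhs; split => //; exact: IU.
have [_ ->] := near_eq_is_derive E3 H3.
set B : 'M[R]_n := 'D_(delta_mx 0 p) J (q t).
have wE : w = v *m J (q t) by exact: velE.
rewrite -/v /= -/w.
have -> : v *m ((B *m G (phi (q t)) + J (q t) *m
     'D_('D_(delta_mx 0 p) phi (q t)) G (phi (q t))) *m (J (q t))^T +
     J (q t) *m G (phi (q t)) *m B^T) *m v^T =
   (v *m B) *m (P t)^T + P t *m (v *m B)^T
     + w *m 'D_('D_(delta_mx 0 p) phi (q t)) G (phi (q t)) *m w^T.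
  rewrite /P -/w wE !trmx_mul symG !mulmxDl !mulmxDr !mulmxDl !mulmxA.
  by rewrite addrAC.
have tr1 (M N : 'rV[R]_n) : (M *m N^T) 0 0 = (N *m M^T) 0 0.
  by rewrite -[M *m _]trmxK trmx_mul trmxK mxE.
have K1 : (P t *m ('D_v J (q t))^T) 0 p = (P t *m (v *m B)^T) 0 0.
  rewrite mxE [RHS]mxE; apply: eq_bigr => a _; congr (_ * _).
  by rewrite mxE [RHS]mxE (jacobian_symmetric _ oU (IU _ It) Cphi).
have K2 : (dP *m (J (q t))^T) 0 p =
    2^-1 * (w *m 'D_('D_(delta_mx 0 p) phi (q t)) G (phi (q t)) *m w^T) 0 0.
  rewrite derive_linear_in_direction // mulmx_sumr mulmx_suml summxE mulr_sumr.
  rewrite mxE; apply: eq_bigr => a _.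
  rewrite -scalemxAr -scalemxAl !mxE [LHS]mulrC.
  by rewrite mulrCA.
set X := _ *m _ *m w^T; rewrite mxE K1 K2 -/X.
have -> : ((v *m B) *m (P t)^T + P t *m (v *m B)^T + X) 0 0 =
    (P t *m (v *m B)^T) 0 0 + (P t *m (v *m B)^T) 0 0 + X 0 0.
  by rewrite mxE [X in X + _]mxE tr1.
by field.
Unshelve. all: by end_near. Qed.

(** The conformal factor disappears for null curves after a change of parameter.
    As k' = om(q o k), the momentum of q o k for G is the momentum of q for om G,
    read at time k. In the gradient of the energy of om G, the derivative of om is
    multiplied by q' G q'^T, which vanishes. *)
Lemma euler_lagrange_conformal (G : 'rV[R]_n -> 'M[R]_n) (om : 'rV[R]_n -> R)
    (q : R -> 'rV[R]_n) (k : R -> R) (I J : set R) s :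
  open I -> open J -> J s -> (forall r, J r -> I (k r)) -> Ck 2 I q ->
  (forall r, J r -> is_derive r 1 k (om (q (k r)))) ->
  differentiable om (q (k s)) -> entrywise_differentiable G (q (k s)) ->
  'D_1 q (k s) *m G (q (k s)) *m ('D_1 q (k s))^T = 0 ->
  euler_lagrange (fun y => om y *: G y) q (k s) -> euler_lagrange G (q \o k) s.
Proof.
move=> oI oJ Js JI Cq dk dom dG null EL p.
have dq r : J r -> derivable q (k r) 1 by move=> /JI Ir; exact: (@Ck_derivable _ _ 1 _ _ _ _ Ir Cq).
have velE r : J r -> 'D_1 (q \o k) r = om (q (k r)) *: 'D_1 q (k r).
  move=> Jr; have H : is_derive r 1 (q \o k) (om (q (k r)) *: 'D_1 q (k r)).
    apply/is_derive_mxP => i j; rewrite mxE [X in is_derive _ _ _ X]mulrC.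
    have Hq : is_derive (k r) 1 (fun s => q s i j) ('D_1 q (k r) i j).
      by have /is_derive_mxP := derivableP (dq r Jr); exact.
    exact: (is_derive1_comp Hq (dk r Jr)).
  by case: H.
set v : 'rV[R]_n := 'D_1 q (k s).
have E1 : \forall r \near s, ((fun u => ('D_1 q u *m (om (q u) *: G (q u))) 0 p) \o k) r
      = ('D_1 (q \o k) r *m G (q (k r))) 0 p.
  near=> r; rewrite /= velE; last by near: r; exact: open_nbhs_nbhs.
  by rewrite -scalemxAl -scalemxAr.
have H1 := is_derive1_comp (EL p) (dk s Js).
apply: (is_derive_eq (near_eq_is_derive E1 H1)).
rewrite velE // -/v.
have dGp : is_derive (q (k s)) (delta_mx 0 p) G ('D_(delta_mx 0 p) G (q (k s))).
  by apply: derivableP; apply/derivable_mxP => a b; exact/diff_derivable/dG.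
have domp : is_derive (q (k s)) (delta_mx 0 p) om ('D_(delta_mx 0 p) om (q (k s))).
  by apply: derivableP; exact/diff_derivable.
have [_ ->] := is_derive_scalemx domp dGp.
rewrite mulmxDr mulmxDl -!scalemxAr -!scalemxAl null scaler0 add0r linearZ /=.
rewrite -!scalemxAr !mxE.
by ring.
Unshelve. all: by end_near. Qed.

End VectorCalculus.

(** * The geodesic equation as an Euler-Lagrange equation *)

Section GeodesicEquation.
Context {R : realType} {n : nat}.

(** H is the metric at a point, D r its derivative along the r-th coordinate, v the
    velocity and a the acceleration. Multiplying the geodesic equation by H removes
    the inverse matrix. *)
Lemma christoffel_lower (H : 'M[R]_n) (D : 'I_n -> 'M[R]_n) (v a : 'rV[R]_n) :
  H \in unitmx -> H^T = H -> (forall r, (D r)^T = D r) ->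
  (forall i, a 0 i + \sum_j \sum_l
      (2^-1 * \sum_p invmx H i p * (D j p l + D l p j - D p j l)) * v 0 j * v 0 l = 0)
  <-> (forall p, (a *m H + v *m \sum_j v 0 j *: D j) 0 p = 2^-1 * (v *m D p *m v^T) 0 0).
Proof.
move=> uH sH sD.
have sHE i j : H i j = H j i by rewrite -{1}sH mxE.
have sDE r i j : D r i j = D r j i by rewrite -{1}(sD r) mxE.
pose c : 'cV[R]_n := \col_p (2^-1 * \sum_j \sum_l (D j p l + D l p j - D p j l) * v 0 j * v 0 l).
have E1 i : a 0 i + \sum_j \sum_l
      (2^-1 * \sum_p invmx H i p * (D j p l + D l p j - D p j l)) * v 0 j * v 0 l
    = (a^T + invmx H *m c) i 0.
  rewrite !mxE; congr (_ + _).
  under [RHS]eq_bigr => p _ do rewrite mxE mulrCA mulr_sumr mulr_sumr.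
  rewrite [RHS]exchange_big; apply: eq_bigr => j _ /=.
  under [RHS]eq_bigr => p _ do rewrite mulr_sumr mulr_sumr.
  rewrite [RHS]exchange_big; apply: eq_bigr => l _ /=.
  rewrite mulr_sumr !mulr_suml; apply: eq_bigr => p _.
  by rewrite !mulrA.
have E2 p : (a *m H + v *m \sum_j v 0 j *: D j) 0 p - 2^-1 * (v *m D p *m v^T) 0 0
    = (H *m a^T + c) p 0.
  have S3 : (v *m D p *m v^T) 0 0 = \sum_j \sum_l D p j l * v 0 j * v 0 l.
    rewrite mxE exchange_big; apply: eq_bigr => l _ /=; rewrite !mxE mulr_suml.
    by apply: eq_bigr => j _; rewrite [v 0 j * _]mulrC.
  have S1 : (v *m \sum_j v 0 j *: D j) 0 p = \sum_j \sum_l D j p l * v 0 j * v 0 l.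
    rewrite mxE exchange_big; apply: eq_bigr => l _ /=; rewrite summxE mulr_sumr.
    by apply: eq_bigr => j _; rewrite mxE sDE; ring.
  have S2 : \sum_j \sum_l D l p j * v 0 j * v 0 l = \sum_j \sum_l D j p l * v 0 j * v 0 l.
    rewrite exchange_big; apply: eq_bigr => j _ /=; apply: eq_bigr => l _; ring.
  have S4 : (a *m H) 0 p = (H *m a^T) p 0.
    by rewrite !mxE; apply: eq_bigr => i _; rewrite mxE mulrC sHE.
  have S5 : c p 0 = 2^-1 * (\sum_j \sum_l D j p l * v 0 j * v 0 l
     + \sum_j \sum_l D l p j * v 0 j * v 0 l - \sum_j \sum_l D p j l * v 0 j * v 0 l).
    rewrite mxE; congr (_ * _); rewrite -big_split /= -sumrB; apply: eq_bigr => j _.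
    rewrite -big_split /= -sumrB; apply: eq_bigr => l _; ring.
  by rewrite mxE S4 S1 S3 [RHS]mxE S5 S2; field.
apply: (@iff_trans _ (a^T + invmx H *m c = 0)).
  split=> [K|K i]; last by rewrite E1 K mxE.
  by apply/matrixP => i j; rewrite (ord1 j) [RHS]mxE -E1 K.
apply: (@iff_trans _ (H *m a^T + c = 0)).
  split=> K.
    have -> : H *m a^T + c = H *m (a^T + invmx H *m c) by rewrite mulmxDr mulKVmx.
    by rewrite K mulmx0.
  have -> : a^T + invmx H *m c = invmx H *m (H *m a^T + c) by rewrite mulmxDr mulKmx.
  by rewrite K mulmx0.
split=> [K p|K].
  by apply/eqP; rewrite -subr_eq0 E2 K mxE.
by apply/matrixP => p j; rewrite (ord1 j) -E2 K subrr mxE.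
Qed.

Lemma geodesic_euler_lagrange (H : 'rV[R]_n -> 'M[R]_n) (q : R -> 'rV[R]_n) (I : set R) t :
  open I -> I t -> Ck 2 I q -> entrywise_differentiable H (q t) ->
  (forall y, (H y)^T = H y) -> H (q t) \in unitmx ->
  (forall i, derive1 (derive1 (fun s => q s 0 i)) t + \sum_(j < n) \sum_(l < n)
     (2^-1 * \sum_(p < n) invmx (H (q t)) i p *
        ('D_(delta_mx 0 j) (fun z => H z p l) (q t)
         + 'D_(delta_mx 0 l) (fun z => H z p j) (q t)
         - 'D_(delta_mx 0 p) (fun z => H z j l) (q t)))
      * derive1 (fun s => q s 0 j) t * derive1 (fun s => q s 0 l) t = 0)
  <-> euler_lagrange H q t.
Proof.
move=> oI It Cq dH sH uH.
have dHu u : derivable H (q t) u.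
  by apply/derivable_mxP => i j; exact: diff_derivable.
have dq s : I s -> derivable q s 1 by move=> Is; exact: (@Ck_derivable _ _ _ 1 _ _ _ _ Is Cq).
have Cq1 : Ck 1 I ('D_1 q) by case: Cq => _ /(_ 1)[].
have ddq : derivable ('D_1 q) t 1 by exact: (@Ck_derivable _ _ _ 0 _ _ _ _ It Cq1).
pose v : 'rV[R]_n := 'D_1 q t; pose a : 'rV[R]_n := 'D_1 ('D_1 q) t.
have vE i s : I s -> derive1 (fun s => q s 0 i) s = 'D_1 q s 0 i.
  by move=> Is; rewrite derive1E (derive_mx (dq s Is)) mxE.
have aE i : derive1 (derive1 (fun s => q s 0 i)) t = a 0 i.
  rewrite derive1E /a (derive_mx ddq) mxE; apply: near_eq_derive.
  by near=> s; apply: vE; near: s; exact: open_nbhs_nbhs.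
pose D r : 'M[R]_n := 'D_(delta_mx 0 r) H (q t).
have DE r i j : 'D_(delta_mx 0 r) (fun z => H z i j) (q t) = D r i j.
  by rewrite /D derive_mx // mxE.
have sD r : (D r)^T = D r.
  apply/matrixP => i j; rewrite mxE -(DE r j i) -(DE r i j); congr ('D__ _ _).
  by apply/funext => z; rewrite -{1}(sH z) mxE.
have EL p : is_derive t 1 (fun s => ('D_1 q s *m H (q s)) 0 p)
    ((a *m H (q t) + v *m \sum_j v 0 j *: D j) 0 p).
  have dHq : is_derive t 1 (H \o q) ('D_v H (q t)).
    exact: (is_derive_comp_mx dH (dq t It)).
  have := is_derive_mulmx (derivableP ddq) dHq.
  by rewrite (derive_linear_in_direction v dH) => /is_derive_mxP/(_ 0 p).
have := @christoffel_lower (H (q t)) D v a uH (sH _) sD.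
move=> C.
have GE i : derive1 (derive1 (fun s => q s 0 i)) t + \sum_(j < n) \sum_(l < n)
     (2^-1 * \sum_(p < n) invmx (H (q t)) i p *
        ('D_(delta_mx 0 j) (fun z => H z p l) (q t)
         + 'D_(delta_mx 0 l) (fun z => H z p j) (q t)
         - 'D_(delta_mx 0 p) (fun z => H z j l) (q t)))
      * derive1 (fun s => q s 0 j) t * derive1 (fun s => q s 0 l) t
    = a 0 i + \sum_j \sum_l
      (2^-1 * \sum_p invmx (H (q t)) i p * (D j p l + D l p j - D p j l)) * v 0 j * v 0 l.
  rewrite aE; congr (_ + _); apply: eq_bigr => j _; apply: eq_bigr => l _.
  rewrite !vE //; congr (_ * _ * _ * _).
  by apply: eq_bigr => p _; rewrite (DE j p l) (DE l p j) (DE p j l).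
apply: (@iff_trans _ (forall i, a 0 i + \sum_j \sum_l
      (2^-1 * \sum_p invmx (H (q t)) i p * (D j p l + D l p j - D p j l)) * v 0 j * v 0 l = 0)).
  by split=> K i; rewrite -[RHS](K i) GE.
apply: (iff_trans C); split=> K p.
  by apply: is_derive_eq (EL p) (K p).
by have [_ <-] := K p; have [_ ->] := EL p.
Unshelve. all: by end_near. Qed.

Lemma euler_lagrange_near (H : 'rV[R]_n -> 'M[R]_n) (q1 q2 : R -> 'rV[R]_n) t :
  (\forall s \near t, q1 s = q2 s) -> euler_lagrange H q1 t -> euler_lagrange H q2 t.
Proof.
move=> q12 EL p; have := EL p; rewrite (near_eq_derive _ q12) (nbhs_singleton q12).
apply: near_eq_is_derive.
move: q12 => /near_join; apply: filterS => s q12.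
by rewrite (near_eq_derive _ q12) (nbhs_singleton q12).
Qed.

End GeodesicEquation.

(** * Charts and tangent vectors *)

Lemma open_preimage_on (S T : topologicalType) (U : set S) (O : set T) (F : S -> T) :
  open U -> (forall x, U x -> {for x, continuous F}) -> open O ->
  open (U `&` F @^-1` O).
Proof.
move=> oU cF oO; rewrite openE => x [Ux Ox].
apply: filterI; first exact: open_nbhs_nbhs.
by apply: (cF x Ux); exact: open_nbhs_nbhs.
Qed.

Section Charts.
Context {R : realType} {n : nat} {M : manifold R n}.
Implicit Types (k : chart R M n) (x : M).

Lemma chart_image k (V : set M) : atlas k ->
  cmap k @` (cdom k `&` V) = [set y | crange k y /\ V (cinv k y)].
Proof.
move=> /atlas_chart[_ _ K _ _]; apply/seteqP; split=> y /=.
  by move=> [x [kx Vx] <-]; rewrite K //; split => //; exists x.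
by move=> [[x kx <-]]; rewrite K // => Vx; exists x.
Qed.

Lemma chart_image_open k (V : set M) : atlas k -> open V ->
  open (cmap k @` (cdom k `&` V)).
Proof.
move=> ak oV; rewrite chart_image //; have [_ oR _ _ ci] := atlas_chart ak.
exact: open_preimage_on.
Qed.

Lemma chart_near k x (V : set M) : atlas k -> cdom k x -> nbhs x V ->
  \forall y \near cmap k x, crange k y /\ V (cinv k y).
Proof.
move=> ak kx nV; have [_ oR K _ ci] := atlas_chart ak.
have ry : crange k (cmap k x) by exists x.
apply: filterI; first exact: open_nbhs_nbhs.
by apply: (ci _ ry); rewrite K.
Qed.

Lemma nbhs_cdom k x : atlas k -> cdom k x -> nbhs x (cdom k).
Proof. by move=> /atlas_chart[oD _ _ _ _] kx; exact: open_nbhs_nbhs. Qed.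

Lemma transition_differentiable k k' x : atlas k -> atlas k' -> cdom k x -> cdom k' x ->
  entrywise_differentiable (cmap k' \o cinv k) (cmap k x).
Proof.
move=> ak ak' kx k'x.
have oO : open (cmap k @` (cdom k `&` cdom k')).
  by apply: chart_image_open => //; have [] := atlas_chart ak'.
have Oy : (cmap k @` (cdom k `&` cdom k')) (cmap k x) by exists x.
exact: (@Ck_entrywise_differentiable _ _ _ 0 _ _ _ oO Oy (atlas_smooth ak ak' _)).
Qed.

(** The chain rule through the transition map between two charts. *)
Lemma derive_change_chart (V : normedModType R) (f : V -> M) k1 k2 (u v : V) :
  atlas k1 -> atlas k2 -> cdom k1 (f u) -> cdom k2 (f u) -> {for u, continuous f} ->
  derivable (cmap k1 \o f) u v ->
  is_derive u v (cmap k2 \o f)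
    ('D_('D_v (cmap k1 \o f) u) (cmap k2 \o cinv k1) (cmap k1 (f u))).
Proof.
move=> a1 a2 d1 d2 cf df.
have [_ _ K _ _] := atlas_chart a1.
have H := is_derive_comp_mx (transition_differentiable a1 a2 d1 d2) df.
have E : \forall z \near u, ((cmap k2 \o cinv k1) \o (cmap k1 \o f)) z = (cmap k2 \o f) z.
  have nk : nbhs u (f @^-1` cdom k1) := cf _ (nbhs_cdom a1 d1).
  by apply: filterS nk => z /= kz; rewrite K.
exact: (near_eq_is_derive E H).
Qed.

(** Row j is the j-th coordinate vector of the chart k at x, as a tangent vector
    in the preferred chart of x. *)
Definition chart_frame k x : 'M[R]_n :=
  jacobian_mx (cmap (chart_at x) \o cinv k) (cmap k x).

Lemma of_chartE k x w : atlas k -> cdom k x -> of_chart k x w = w *m chart_frame k x.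
Proof.
move=> ak kx; apply: derive_jacobian.
by apply: transition_differentiable => //; [exact: chart_at_atlas|exact: chart_at_dom].
Qed.

Lemma to_chartE k x w : atlas k -> cdom k x ->
  to_chart k x w = w *m jacobian_mx (cmap k \o cinv (chart_at x)) (cmap (chart_at x) x).
Proof.
move=> ak kx; apply: derive_jacobian.
by apply: transition_differentiable => //; [exact: chart_at_atlas|exact: chart_at_dom].
Qed.

(** The transition maps between k and the preferred chart are inverse to each
    other near x, hence so are their differentials. *)
Lemma of_chartK k x w : atlas k -> cdom k x -> to_chart k x (of_chart k x w) = w.
Proof.
move=> ak kx; have [_ _ K _ ci] := atlas_chart ak.
have ac := chart_at_atlas x; have dc := chart_at_dom x.
have ry : crange k (cmap k x) by exists x.
have Kx := K _ kx.
have dt : derivable (cmap (chart_at x) \o cinv k) (cmap k x) w.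
  by apply/derivable_mxP => i j; exact/diff_derivable/(transition_differentiable ak ac kx dc).
have H := @derive_change_chart _ (cinv k) (chart_at x) k (cmap k x) w ac ak.
rewrite Kx in H; have {}H := H dc kx (ci _ ry) dt.
have E : \forall z \near cmap k x, (cmap k \o cinv k) z = z.
  have nk := chart_near ak kx (nbhs_cdom ak kx); apply: filterS nk => z /= [[x' kx' <-] _].
  by rewrite K.
have H' := near_eq_is_derive E H.
rewrite /to_chart /of_chart; have [_ <-] := H'.
exact: derive_id.
Qed.

Lemma chart_frame_unit k x : atlas k -> cdom k x -> chart_frame k x \in unitmx.
Proof.
move=> ak kx.
suff : chart_frame k x *m jacobian_mx (cmap k \o cinv (chart_at x)) (cmap (chart_at x) x) = 1%:M.
  by case/mulmx1_unit.
apply/row_matrixP => i; rewrite rowE [RHS]rowE mulmx1 mulmxA.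
by rewrite -of_chartE // -to_chartE // of_chartK.
Qed.

Lemma velocity_of_chart (c : R -> M) k t : atlas k -> cdom k (c t) ->
  {for t, continuous c} -> derivable (cmap k \o c) t 1 ->
  velocity c t = of_chart k (c t) ('D_1 (cmap k \o c) t).
Proof.
move=> ak kc cc dc; rewrite /velocity derive1E.
by have [_ ->] := derive_change_chart ak (chart_at_atlas (c t)) kc (chart_at_dom (c t)) cc dc.
Qed.

Lemma smooth_map_derivable (c : R -> M) (I : set R) k t : smooth_map I c ->
  I t -> atlas k -> cdom k (c t) -> derivable (cmap k \o c) t 1.
Proof.
move=> [_ sc] It ak kc.
by have [_ /(_ 1)[+ _]] := sc k ak 1%N; apply; split.
Qed.

Lemma smooth_map_velocity (c : R -> M) (I : set R) k t : smooth_map I c ->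
  I t -> atlas k -> cdom k (c t) ->
  velocity c t = of_chart k (c t) ('D_1 (cmap k \o c) t).
Proof.
move=> sc It ak kc; apply: velocity_of_chart => //; first by case: sc => + _; exact.
exact: smooth_map_derivable sc It ak kc.
Qed.

Lemma smooth_map_open (V : normedModType R) (U : set V) (c : V -> M) (O : set M) :
  open U -> smooth_map U c -> open O -> open (U `&` c @^-1` O).
Proof. by move=> oU [cc _]; exact: open_preimage_on. Qed.

Lemma smooth_map_sub (V : normedModType R) (U U' : set V) (c : V -> M) :
  U' `<=` U -> smooth_map U c -> smooth_map U' c.
Proof.
move=> sU [cc sc]; split; first by move=> u /sU; exact: cc.
move=> k ak j; apply: Ck_sub (sc k ak j) => u [Uu ku]; split => //; exact: sU.
Qed.

End Charts.

(** * Smooth maps between manifolds *)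

Section SmoothComposition.
Context {R : realType} {n : nat} {M M' : manifold R n}.

Definition chart_repr (F : M -> M') (k : chart R M n) (k' : chart R M' n) :=
  cmap k' \o F \o cinv k.

Definition chart_repr_dom (U : set M) (F : M -> M') (k : chart R M n) (k' : chart R M' n) :=
  cmap k @` (cdom k `&` U `&` F @^-1` cdom k').

Lemma chart_repr_dom_open (U : set M) (F : M -> M') k k' : open U ->
  smooth_between U F -> atlas k -> atlas k' -> open (chart_repr_dom U F k k').
Proof.
move=> oU [cF _] ak ak'; rewrite /chart_repr_dom -setIA; apply: chart_image_open => //.
by apply: open_preimage_on => //; have [] := atlas_chart ak'.
Qed.

Lemma chart_repr_dom_self (U : set M) (F : M -> M') (k : chart R M n) (k' : chart R M' n) x :
  U x -> cdom k x -> cdom k' (F x) -> chart_repr_dom U F k k' (cmap k x).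
Proof. by move=> Ux kx k'x; exists x. Qed.

(** Locally, c is read in the preferred chart at the point under consideration and
    F between this chart and the given one. *)
Lemma smooth_map_comp (V : normedModType R) (U : set V) (c : V -> M) (O : set M)
    (F : M -> M') : open U -> open O -> smooth_map U c -> smooth_between O F ->
  (forall u, U u -> O (c u)) -> smooth_map U (F \o c).
Proof.
move=> oU oO sc sF UO; have [cc sc'] := sc; have [cF sF'] := sF.
split; first by move=> u Uu; apply: continuous_comp; [exact: cc|apply/cF/UO].
move=> k' ak' j; apply: Ck_local => u [Uu k'u].
pose k := chart_at (c u); have ak : atlas k := chart_at_atlas (c u).
have ku : cdom k (c u) := chart_at_dom (c u).
have [oD _ K _ _] := atlas_chart ak; have [oD' _ _ _ _] := atlas_chart ak'.
pose W := U `&` (c @^-1` (cdom k `&` (O `&` F @^-1` cdom k'))).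
have oW : open W.
  apply: smooth_map_open => //; apply: openI => //; exact: open_preimage_on.
exists W; first by split => //; split => //; split=> //; exact: UO.
rewrite setIidr; last by move=> z [Uz [kz [Oz Fz]]].
have C1 : Ck j W (cmap k \o c).
  by apply: Ck_sub (sc' k ak j) => z [Uz [kz _]].
have C2 := sF' k k' ak ak' j.
have oRD := chart_repr_dom_open oO sF ak ak'.
have WO z : W z -> chart_repr_dom O F k k' ((cmap k \o c) z).
  by move=> [Uz [kz [Oz Fz]]]; exists (c z).
have := Ck_comp oW oRD WO C1 C2.
by apply: Ck_eq => // z /set_mem [_ [kz _]] /=; rewrite K.
Qed.

Lemma smooth_function_comp (V : normedModType R) (U : set V) (c : V -> M) (f : M -> R) :
  open U -> smooth_map U c -> smooth_function setT f -> smooth_on U (f \o c).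
Proof.
move=> oU sc sf j; have [cc sc'] := sc; apply: Ck_local => u Uu.
pose k := chart_at (c u); have ak : atlas k := chart_at_atlas (c u).
have ku : cdom k (c u) := chart_at_dom (c u).
have [oD _ K _ _] := atlas_chart ak.
pose W := U `&` c @^-1` cdom k.
have oW : open W by exact: smooth_map_open.
exists W; first by [].
rewrite setIidr; last by move=> z [].
have C1 : Ck j W (cmap k \o c) by exact: sc'.
have oRD : open (cmap k @` (cdom k `&` setT)) by apply: chart_image_open => //; exact: openT.
have WO z : W z -> (cmap k @` (cdom k `&` setT)) ((cmap k \o c) z).
  by move=> [Uz kz]; exists (c z).
have := Ck_comp_scalar oW oRD WO C1 (sf k ak j).
by apply: Ck_eq => // z /set_mem [_ kz] /=; rewrite K.
Qed.

Lemma smooth_map_reparam (I J : set R) (c : R -> M) (h : R -> R) :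
  open I -> open J -> smooth_map I c -> smooth_on J h -> (forall s, J s -> I (h s)) ->
  smooth_map J (c \o h).
Proof.
move=> oI oJ sc sh JI; have [cc sc'] := sc.
have ch s : J s -> {for s, continuous h} by case: (sh 0%N) => + _; exact.
split; first by move=> s Js; apply: continuous_comp; [exact: ch|apply/cc/JI].
move=> k ak j; have [oD _ _ _ _] := atlas_chart ak.
have oIk : open (I `&` c @^-1` cdom k) by exact: smooth_map_open.
have oJk : open (J `&` (c \o h) @^-1` cdom k).
  rewrite (_ : _ `&` _ = J `&` h @^-1` (I `&` c @^-1` cdom k)).
    exact: open_preimage_on.
  by apply/seteqP; split=> s /= [Js]; [split=> //; split=> //; exact: JI | case].
apply: (@Ck_comp1 _ _ _ _ _ (I `&` c @^-1` cdom k) (cmap k \o c) h) => //.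
- by move=> s [Js ks]; split=> //; exact: JI.
- by apply: Ck_sub (sh j) => s [].
- exact: sc'.
Qed.

(** Both sides are the derivative of F read from the chart k to the preferred chart
    at F x: the left one goes through the preferred chart at x, the right one
    through k'. *)
Lemma differential_of_chart (U : set M) (F : M -> M') k k' x w : open U ->
  smooth_between U F -> U x -> atlas k -> atlas k' -> cdom k x -> cdom k' (F x) ->
  differential_at F x (of_chart k x w)
    = of_chart k' (F x) ('D_w (chart_repr F k k') (cmap k x)).
Proof.
move=> oU sF Ux ak ak' kx k'x; have [cF sF'] := sF.
have [_ _ K _ ci] := atlas_chart ak.
have ac := chart_at_atlas x; have dc := chart_at_dom x.
have [_ _ Kc _ _] := atlas_chart ac.
have ac' := chart_at_atlas (F x); have dc' := chart_at_dom (F x).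
have ry : crange k (cmap k x) by exists x.
have diffE h h' (ah : atlas h) (ah' : atlas h') (hx : cdom h x) (h'x : cdom h' (F x)) :
    entrywise_differentiable (chart_repr F h h') (cmap h x).
  exact: (@Ck_entrywise_differentiable _ _ _ 0 _ _ _ (chart_repr_dom_open oU sF ah ah')
    (chart_repr_dom_self Ux hx h'x) (sF' h h' ah ah' 1%N)).
have cFk : {for cmap k x, continuous (F \o cinv k)}.
  by apply: continuous_comp; [exact: ci|rewrite K //; exact: cF].
have dphi : derivable (cmap k' \o (F \o cinv k)) (cmap k x) w.
  by apply/derivable_mxP => i j; exact/diff_derivable/(diffE k k').
have H1 := @derive_change_chart _ _ _ _ (F \o cinv k) k' (chart_at (F x)) (cmap k x) w ak' ac'.
rewrite /= K // in H1; have {}H1 := H1 k'x dc' cFk dphi.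
rewrite [RHS]/of_chart.
have [_ <-] := H1.
(* the same derivative through the preferred chart of M *)
have dt : derivable (cmap (chart_at x) \o cinv k) (cmap k x) w.
  by apply/derivable_mxP => i j; exact/diff_derivable/(transition_differentiable ak ac kx dc).
have dG : entrywise_differentiable (chart_repr F (chart_at x) (chart_at (F x)))
    ((cmap (chart_at x) \o cinv k) (cmap k x)).
  by rewrite /= K //; exact: diffE.
have H2 := is_derive_comp_mx dG dt.
have E : \forall z \near cmap k x,
    (chart_repr F (chart_at x) (chart_at (F x)) \o (cmap (chart_at x) \o cinv k)) z
    = (cmap (chart_at (F x)) \o (F \o cinv k)) z.
  have nk := chart_near ak kx (nbhs_cdom ac dc); apply: filterS nk => z [_ /= Vz].
  by rewrite /chart_repr /= Kc.
have [_ ->] := near_eq_is_derive E H2.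
by rewrite /= K.
Qed.

Lemma velocity_comp (I : set R) (c : R -> M) (O : set M) (F : M -> M') t :
  open I -> open O -> smooth_map I c -> smooth_between O F ->
  (forall u, I u -> O (c u)) -> I t ->
  velocity (F \o c) t = differential_at F (c t) (velocity c t).
Proof.
move=> oI oO sc sF IO It.
have ak := chart_at_atlas (c t); have dk := chart_at_dom (c t).
have ak' := chart_at_atlas (F (c t)); have dk' := chart_at_dom (F (c t)).
have [_ _ K _ _] := atlas_chart ak.
set k := chart_at (c t) in ak dk K *; set k' := chart_at (F (c t)) in ak' dk'.
have sFc := smooth_map_comp oI oO sc sF IO.
rewrite (smooth_map_velocity sFc It ak' dk') (smooth_map_velocity sc It ak dk).
rewrite (differential_of_chart _ oO sF (IO _ It) ak ak' dk dk'); congr (of_chart _ _ _).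
have dq := smooth_map_derivable sc It ak dk.
have dphi : entrywise_differentiable (chart_repr F k k') ((cmap k \o c) t).
  exact: (@Ck_entrywise_differentiable _ _ _ 0 _ _ _ (chart_repr_dom_open oO sF ak ak')
    (chart_repr_dom_self (IO _ It) dk dk') (sF.2 k k' ak ak' 1%N)).
have H := is_derive_comp_mx dphi dq.
have E : \forall z \near t, (chart_repr F k k' \o (cmap k \o c)) z = (cmap k' \o (F \o c)) z.
  have nk : nbhs t (c @^-1` cdom k) := sc.1 _ It _ (nbhs_cdom ak dk).
  by apply: filterS nk => z /= kz; rewrite /chart_repr /= K.
by have [_ ->] := near_eq_is_derive E H.
Qed.

End SmoothComposition.

(** * The metric in a chart *)

Section MetricInCharts.
Context {R : realType} {m : nat} {M : manifold R m.+1} (g : spacetime M).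
Implicit Types (k : chart R M m.+1) (x : M).

Lemma bilinear_delta n (A : 'M[R]_n) i j :
  ((delta_mx 0 i : 'rV[R]_n) *m A *m (delta_mx 0 j : 'rV[R]_n)^T) 0 0 = A i j.
Proof. by rewrite -rowE trmx_delta -colE !mxE. Qed.

(** The matrix of g in the chart k is the Gram matrix of the coordinate vectors. *)
Lemma gmat_frame k x : atlas k -> cdom k x ->
  gmat (metric g) k (cmap k x) = chart_frame k x *m metric g x *m (chart_frame k x)^T.
Proof.
move=> ak kx; have [_ _ K _ _] := atlas_chart ak.
apply/matrixP => i j; rewrite mxE K // !of_chartE // /gform -[RHS]bilinear_delta.
by rewrite trmx_mul !mulmxA.
Qed.

Lemma gform_of_chart k x v w : atlas k -> cdom k x ->
  gform (metric g) x (of_chart k x v) (of_chart k x w)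
    = (v *m gmat (metric g) k (cmap k x) *m w^T) 0 0.
Proof.
by move=> ak kx; rewrite gmat_frame // !of_chartE // /gform trmx_mul !mulmxA.
Qed.

Lemma gmat_sym k y : (gmat (metric g) k y)^T = gmat (metric g) k y.
Proof.
apply/matrixP => i j; rewrite !mxE /gform.
set v := of_chart _ _ _; set w := of_chart _ _ _.
have tr11 (A : 'M[R]_1) : A^T 0 0 = A 0 0 by rewrite mxE.
apply: etrans (esym (tr11 _)) _.
by rewrite !trmx_mul trmxK metric_sym mulmxA.
Qed.

(** By the normal form of a Lorentz metric, whose determinant is -1. *)
Lemma metric_unit x : metric g x \in unitmx.
Proof.
have [P uP e] := metric_lorentz g x.
have : P *m metric g x *m P^T \in unitmx.
  rewrite e unitmxE det_diag unitfE; apply/prodf_neq0 => i _; rewrite mxE.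
  by case: ifP => _; rewrite ?oppr_eq0 oner_eq0.
by rewrite !unitmx_mul => /andP[/andP[]].
Qed.

Lemma gmat_unit k x : atlas k -> cdom k x -> gmat (metric g) k (cmap k x) \in unitmx.
Proof.
move=> ak kx; rewrite gmat_frame // !unitmx_mul unitmx_tr metric_unit andbT.
by rewrite chart_frame_unit.
Qed.

Lemma gmat_differentiable k x : atlas k -> cdom k x ->
  entrywise_differentiable (gmat (metric g) k) (cmap k x).
Proof.
move=> ak kx i j; have [_ oR _ _ _] := atlas_chart ak.
have rx : crange k (cmap k x) by exists x.
exact: Ck_differentiable oR rx (@metric_smooth _ _ _ g k ak i j 1%N).
Qed.

Lemma gformZl x a v w : gform (metric g) x (a *: v) w = a * gform (metric g) x v w.
Proof. by rewrite /gform -!scalemxAl mxE. Qed.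

Lemma gformZr x a v w : gform (metric g) x v (a *: w) = a * gform (metric g) x v w.
Proof. by rewrite /gform linearZ /= -scalemxAr mxE. Qed.

Lemma future_scale x v a : 0 < a -> future g x v -> future g x (a *: v).
Proof.
move=> a0; have [U [T [_ Ux _ H]]] := future_cone g x.
have [_ F] := H x Ux; move=> /F[v0 vv vT]; apply/F.
split; first by rewrite scaler_eq0 negb_or v0 andbT gt_eqF.
  by rewrite gformZl gformZr !pmulr_rle0.
by rewrite gformZl pmulr_rlt0.
Qed.

Lemma velocity_reparam (I : set R) (c : R -> M) (h : R -> R) s dh :
  smooth_map I c -> I (h s) -> is_derive s 1 h dh ->
  velocity (c \o h) s = dh *: velocity c (h s).
Proof.
move=> sc Ih hs; rewrite /velocity !derive1E.
set k := chart_at _.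
have dq : derivable (cmap k \o c) (h s) 1.
  apply: smooth_map_derivable sc Ih _ _; [exact: chart_at_atlas|exact: chart_at_dom].
have H : is_derive s 1 (cmap k \o (c \o h)) (dh *: 'D_1 (cmap k \o c) (h s)).
  apply/is_derive_mxP => i j; rewrite mxE [X in is_derive _ _ _ X]mulrC.
  have Hq : is_derive (h s) 1 (fun s => (cmap k \o c) s i j) ('D_1 (cmap k \o c) (h s) i j).
    by have /is_derive_mxP := derivableP dq; exact.
  exact: (is_derive1_comp Hq hs).
by case: H.
Qed.

Lemma geodesic_equation_in_chart (I : set R) (c : R -> M) k t :
  open I -> smooth_map I c -> I t -> atlas k -> cdom k (c t) ->
  (forall i : 'I_m.+1,
     let q j := fun s : R => cmap k (c s) 0 j in
     derive1 (derive1 (q i)) t +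
     \sum_(j < m.+1) \sum_(l < m.+1)
       christoffel (metric g) k (cmap k (c t)) i j l * derive1 (q j) t * derive1 (q l) t
     = 0) <-> euler_lagrange (gmat (metric g) k) (cmap k \o c) t.
Proof.
move=> oI sc It ak kc; have [oD _ _ _ _] := atlas_chart ak.
have oIk : open (I `&` c @^-1` cdom k) by exact: smooth_map_open.
exact: (geodesic_euler_lagrange oIk (conj It kc) (sc.2 k ak 2%N)
  (gmat_differentiable ak kc) (gmat_sym k) (gmat_unit ak kc)).
Qed.

End MetricInCharts.

(** * Null geodesics under a conformal map *)

Section ConformalPullback.
Context {R : realType} {m : nat} {X Xt : manifold R m.+1}.
Variables (g : spacetime X) (gt : spacetime Xt) (Phi : X -> Xt) (Om : X -> R).
Hypotheses (Phi_smooth : smooth_between setT Phi)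
  (Om_smooth : smooth_function setT Om) (Om_gt0 : forall x, 0 < Om x)
  (conformal : forall x v w, Om x * gform (metric g) x v w =
     gform (metric gt) (Phi x) (differential_at Phi x v) (differential_at Phi x w)).

(** The conformality of Phi tested on coordinate vectors. *)
Lemma conformal_gmat k k' y : atlas k -> atlas k' -> chart_repr_dom setT Phi k k' y ->
  Om (cinv k y) *: gmat (metric g) k y =
    jacobian_mx (chart_repr Phi k k') y *m gmat (metric gt) k' (chart_repr Phi k k' y)
      *m (jacobian_mx (chart_repr Phi k k') y)^T.
Proof.
move=> ak ak' [x [[kx _] k'x] <-]; have [_ _ K _ _] := atlas_chart ak.
set phi := chart_repr Phi k k'.
have dphi : entrywise_differentiable phi (cmap k x).
  exact: (@Ck_entrywise_differentiable _ _ _ 0 _ _ _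
    (chart_repr_dom_open openT Phi_smooth ak ak')
    (chart_repr_dom_self I kx k'x) (Phi_smooth.2 k k' ak ak' 1%N)).
apply/matrixP => i j.
have -> : (Om (cinv k (cmap k x)) *: gmat (metric g) k (cmap k x)) i j =
   Om x * gform (metric g) x (of_chart k x (delta_mx 0 i)) (of_chart k x (delta_mx 0 j)).
  by rewrite mxE gform_of_chart // bilinear_delta K.
rewrite conformal !(differential_of_chart _ openT Phi_smooth I ak ak' kx k'x).
rewrite gform_of_chart // !(derive_jacobian _ dphi) -[RHS]bilinear_delta trmx_mul !mulmxA.
by rewrite /phi /chart_repr /= K.
Qed.

(** In charts, the geodesic c' = Phi o d of gt satisfies the Euler-Lagrange equation
    for the matrix of gt. It can be pulled back by Phi, which turns it into the
    equation of d for Om g. As d is null, the parameter change h absorbs Om. *)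
Lemma conformal_pullback_geodesic (J J' : set R) (c' : R -> Xt) (d : R -> X) (h : R -> R) :
  open J -> open J' -> geodesic_on (metric gt) J c' -> smooth_map J d ->
  (forall t, J t -> Phi (d t) = c' t) ->
  (forall t, J t -> gform (metric gt) (c' t) (velocity c' t) (velocity c' t) = 0) ->
  (forall s, J' s -> J (h s)) -> smooth_on J' h ->
  (forall s, J' s -> is_derive s 1 h (Om (d (h s)))) ->
  geodesic_on (metric g) J' (d \o h).
Proof.
move=> oJ oJ' [sc' geo] sd Phid null J'J sh dh.
have se : smooth_map J' (d \o h) by exact: smooth_map_reparam sd sh J'J.
split=> // k s ak J's ks.
apply/(geodesic_equation_in_chart g oJ' se J's ak ks).
pose t := h s; have Jt : J t by exact: J'J.
pose k' := chart_at (c' t); have ak' : atlas k' := chart_at_atlas (c' t).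
have k't : cdom k' (c' t) := chart_at_dom (c' t).
have EL' := (geodesic_equation_in_chart gt oJ sc' Jt ak' k't).1 (geo k' t ak' Jt k't).
pose q := cmap k \o d; pose phi := chart_repr Phi k k'.
pose U := chart_repr_dom setT Phi k k'.
have [oD _ K _ _] := atlas_chart ak; have [oD' _ K' _ _] := atlas_chart ak'.
pose I0 := (J `&` d @^-1` cdom k) `&` (J `&` c' @^-1` cdom k').
have oI0 : open I0 by exact: openI (smooth_map_open oJ sd oD) (smooth_map_open oJ sc' oD').
have I0t : I0 t by [].
have oU : open U by exact: (chart_repr_dom_open openT Phi_smooth ak ak').
have I0U r : I0 r -> U (q r).
  by move=> [[Jr kr] [_ k'r]]; exists (d r) => //; split=> //=; rewrite Phid.
have Cphi : Ck 2 U phi by exact: (Phi_smooth.2 k k' ak ak' 2%N).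
have Cq : Ck 2 I0 q by apply: Ck_sub (sd.2 k ak 2%N) => r [].
have qE : \forall r \near t, (cmap k' \o c') r = (phi \o q) r.
  have : nbhs t I0 by exact: open_nbhs_nbhs.
  apply: filterS => r [[Jr kr] _]; rewrite /phi /q /chart_repr /= K //.
  by rewrite Phid.
have {}EL' := euler_lagrange_near qE EL'.
have phit : phi (q t) = cmap k' (c' t) by exact: (esym (nbhs_singleton qE)).
have dG' : entrywise_differentiable (gmat (metric gt) k') (phi (q t)).
  by rewrite phit; exact: gmat_differentiable.
have EL := euler_lagrange_pullback oU Cphi oI0 I0t I0U Cq dG' (gmat_sym gt k')
  (fun y Uy => conformal_gmat ak ak' Uy) EL'.
have oJ0 : open (J' `&` h @^-1` I0).
  apply: open_preimage_on => // r J'r.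
  by case: (sh 0%N) => + _; exact.
apply: (@euler_lagrange_conformal _ _ (gmat (metric g) k) (fun y => Om (cinv k y)) q h I0
  (J' `&` h @^-1` I0) s) => //.
- by move=> r [].
- move=> r [J'r [[Jr kr] _]]; rewrite /q /= K //; exact: dh.
- have oR : open (cmap k @` (cdom k `&` setT)) by apply: chart_image_open => //; exact: openT.
  have Rq : (cmap k @` (cdom k `&` setT)) (q t) by exists (d t).
  exact: Ck_differentiable oR Rq (Om_smooth ak 1%N).
- exact: gmat_differentiable.
(* the velocity of d is null for g because that of c' is null for gt *)
- have velE : velocity c' t = differential_at Phi (d t) (velocity d t).
    have := velocity_comp oJ openT sd Phi_smooth (fun _ _ => I) Jt => <-.
    rewrite /velocity /= Phid // !derive1E; apply: near_eq_derive.
    have : nbhs t J by exact: open_nbhs_nbhs.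
    by apply: filterS => r Jr /=; rewrite Phid.
  have n0 := null t Jt; rewrite velE -Phid // -conformal in n0.
  move/eqP: n0; rewrite mulf_eq0 (gt_eqF (Om_gt0 _)) /= => /eqP.
  rewrite (smooth_map_velocity sd Jt ak ks) gform_of_chart // => n0.
  by apply/matrixP => i j; rewrite (ord1 i) (ord1 j) n0 mxE.
Qed.

End ConformalPullback.

(** * Light rays and skies under a conformal open embedding *)

Section RayPullback.
Context {R : realType} {m : nat} {X Xt : manifold R m.+1}.
Variables (g : spacetime X) (gt : spacetime Xt) (Phi : X -> Xt).
Hypothesis embedding : conformal_open_embedding g gt Phi.

Lemma causal_future_image x y : causal_future g x y -> causal_future gt (Phi x) (Phi y).
Proof.
have [_ _ sPhi _ [Om [_ _ _ fut]]] := embedding.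
case=> [->|[a [b [c [[ab [I [oI abI sc cfut]]] <- <-]]]]]; [by left|right].
exists a, b, (Phi \o c); split=> //; split=> //; exists I; split=> //.
  exact: (smooth_map_comp oI openT sc sPhi).
move=> t tab; rewrite (velocity_comp oI openT sc sPhi (fun _ _ => Logic.I) (abI t tab)).
by apply/fut/cfut.
Qed.

Lemma causally_related_image x y :
  causally_related g x y -> causally_related gt (Phi x) (Phi y).
Proof. by case=> /causal_future_image; [left|right]. Qed.

Lemma ray_represents (M : manifold R m.+1) (h : spacetime M) (L : light_ray h) I c :
  represents I c L -> null_geodesic h I c /\ inextendible I c.
Proof.
case: L => L pL; rewrite /represents /= => Lc; have [I0 [c0 [_ _ LE]]] := pL.
by move: Lc; rewrite LE => -[].
Qed.

(** All geodesics that represent L run through the same points, in particular the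
    one whose image is an arc of L'. *)
Lemma through_image (L : light_ray g) (L' : light_ray gt) x : ray_contains Phi L' L -> through L x -> through L' (Phi x).
Proof.
move=> [I1 [c1 [rep1 [I2 [c2 [rep2 [h3 [_ _ h3I e3]]]]]]]] [I [c [t [rep It ctx]]]].
have [I0 [c0 [_ _ LE]]] := svalP L; move: rep1 rep; rewrite /represents LE.
move=> [_ _ [h2 [_ _ h2I e2]]] [_ _ [h1 [_ _ h1I e1]]] /=.
have [s I1s hs] : (h2 @` I1) (h1 t) by rewrite h2I -h1I; exists t.
exists I2, c2, (h3 s); split=> //; first by apply: h3I; exists s.
rewrite -(e3 s I1s) -ctx /=; congr Phi.
by apply: etrans (e2 s I1s) _; rewrite hs; exact: esym (e1 t It).
Qed.

Lemma ray_of_geodesic (M : manifold R m.+1) (h : spacetime M) I c :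
  null_geodesic h I c -> inextendible I c -> exists L : light_ray h, represents I c L.
Proof.
move=> nc ic.
pose L := [set d | [/\ null_geodesic h d.1 d.2, inextendible d.1 d.2 &
                     reparametrization d.1 d.2 I c]].
have rL : is_ray h L by exists I, c.
exists (exist _ L rL); split=> //=; exists id; split=> //.
- by move=> k; apply: (@Ck_linear _ _ _ _ _ idfun) => x; exact: cvg_id.
- by move=> t _; rewrite derive1E derive_id.
- by rewrite image_id.
Qed.

(** The piece of L' in the image of Phi around Phi x is pulled back to X and
    reparametrized into a null geodesic. This geodesic is inextendible in X: an
    endpoint p in X would give the point Phi p either as an endpoint of L' or as a
    point where L' leaves the open image of Phi, and both are impossible. *)
Lemma ray_pullback (L' : light_ray gt) x : through L' (Phi x) ->
  exists L : light_ray g, through L x /\ ray_contains Phi L' L.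
Proof.
have [Phi_inj oPhi sPhi [Psi [PhiK sPsi]] [Om [sOm Om0 conf fut]]] := embedding.
move=> [I' [c' [t0 [rep It0 ct0]]]].
have [[oI' iI' _ [sc' geo] fc'] ext'] := ray_represents rep.
pose J := interval_component (I' `&` c' @^-1` range Phi) t0.
have Jt0 : J t0 by apply: interval_component_self; split=> //; exists x.
have oJ : open J by apply: interval_component_open; exact: smooth_map_open.
have iJ : is_interval J by exact: interval_component_interval.
have JI t : J t -> I' t by move=> /interval_component_sub[].
have JPhi t : J t -> range Phi (c' t) by move=> /interval_component_sub[].
pose d := Psi \o c'.
have sc'J : smooth_map J c' by exact: smooth_map_sub sc'.
have sd : smooth_map J d by exact: (smooth_map_comp oJ oPhi sc'J sPsi).
have Phid t : J t -> Phi (d t) = c' t by move=> /JPhi[y _ cy]; rewrite /d /= -cy PhiK.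
have sOmd : smooth_on J (Om \o d) := smooth_function_comp oJ sd sOm.
(* the affine parameter of g along d is a primitive of 1 / Om *)
have [H dH] : exists H : R -> R, forall t, J t -> is_derive t 1 H (Om (d t))^-1.
  apply: (antiderivative_exists (f := fun t => (Om (d t))^-1) oJ iJ Jt0) => t Jt.
  apply: continuousV; first by rewrite gt_eqF.
  by case: (sOmd 0%N) => + _; exact.
have f0 t : J t -> 0 < (Om (d t))^-1 by rewrite invr_gt0.
have [k [oJ' iJ' kH Hlt dk]] := increasing_inverse oJ iJ dH f0.
set J' := H @` J in oJ' iJ'.
have J'J s : J' s -> J (k s) by move=> [t Jt <-]; rewrite kH.
have Hk s : J' s -> H (k s) = s by move=> [t Jt <-]; rewrite kH.
have dk' s : J' s -> is_derive s 1 k (Om (d (k s))).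
  by move=> [t Jt <-]; rewrite kH // -[Om _]invrK; exact: dk.
have sk : smooth_on J' k.
  move=> j; exact: (Ck_ode oJ' oJ J'J dk' (sOmd j)).
pose e := d \o k.
have velE t : J t -> velocity c' t = differential_at Phi (d t) (velocity d t).
  move=> Jt; have := velocity_comp oJ openT sd sPhi (fun _ _ => Logic.I) Jt => <-.
  rewrite /velocity /= Phid // !derive1E; apply: near_eq_derive.
  have : nbhs t J by exact: open_nbhs_nbhs.
  by apply: filterS => r Jr /=; rewrite Phid.
have vele s : J' s -> velocity e s = Om (d (k s)) *: velocity d (k s).
  by move=> J's; exact: (velocity_reparam sd (J'J s J's) (dk' s J's)).
have ne : null_geodesic g J' e.
  split=> //.
  - by exists (H t0); exists t0.
  - apply: (conformal_pullback_geodesic sPhi sOm Om0 conf oJ oJ' _ sd Phid) => //.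
    + by split=> // k0 t ak0 /JI It; exact: geo.
    + by move=> t /JI/fc'[].
  - move=> s J's; rewrite vele // /e /=; have Jks := J'J s J's.
    have [fks nks] := fc' _ (JI _ Jks); split.
      by apply: future_scale => //; apply/fut; rewrite -velE // Phid.
    rewrite gformZl gformZr; move: nks; rewrite velE // -Phid // -conf => /eqP.
    by rewrite mulf_eq0 (gt_eqF (Om0 _)) /= => /eqP ->; rewrite !mulr0.
have cc' t : I' t -> {for t, continuous c'} by case: sc' => + _; exact.
have hTt := @msort_hausdorff _ _ Xt.
have ie : inextendible J' e.
  move=> p; have cPhi : {for p, continuous Phi} by case: sPhi => + _; exact.
  have rp : range Phi (Phi p) by exists p.
  have [nf np] := ext' (Phi p); split=> K; [apply: nf|apply: np].
    apply: (no_upper_limit hTt iI' cc' oI' oPhi rp Jt0) => W nW.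
    have [s1 J's1 Ws1] := K _ (cPhi _ nW); exists (k s1); first exact: J'J.
    move=> t Jt kt; rewrite -Phid // -[t]kH //; apply: Ws1; first by exists t.
    by rewrite -(Hk _ J's1) leNgt Hlt // -?leNgt //; exact: J'J.
  apply: (no_lower_limit hTt iI' cc' oI' oPhi rp Jt0) => W nW.
  have [s1 J's1 Ws1] := K _ (cPhi _ nW); exists (k s1); first exact: J'J.
  move=> t Jt kt; rewrite -Phid // -[t]kH //; apply: Ws1; first by exists t.
  by rewrite -(Hk _ J's1) leNgt Hlt // -?leNgt //; exact: J'J.
have [L repL] := ray_of_geodesic ne ie.
exists L; split.
  exists J', e, (H t0); split=> //; first by exists t0.
  by rewrite /e /= kH // /d /= ct0 PhiK.
exists J', e; split=> //; exists I', c'; split=> //; exists k; split=> //.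
- by move=> s J's; rewrite derive1E; have [_ ->] := dk' s J's; exact: Om0.
- by move=> _ [s J's <-]; exact/JI/J'J.
- by move=> s J's; rewrite /= Phid //; exact: J'J.
Qed.

Variable i : light_ray g -> light_ray gt.
Hypothesis i_inclusion : ray_inclusion Phi i.

(** One inclusion holds because i L contains the image of L, the other because every
    ray through Phi x comes from a ray through x. *)
Lemma sky_image x : i @` sky g x = sky gt (Phi x).
Proof.
apply/seteqP; split=> [_ [L Lx <-]|L' /ray_pullback[L [Lx LL']]].
  by apply: through_image Lx; have [] := i_inclusion L.
by exists L => //; have [_ /(_ L' LL')] := i_inclusion L.
Qed.

(** A ray of Xt through both points comes from a ray through x and from one through
    y, and these agree by injectivity of i. *)
Lemma on_same_null_geodesic_image x y : injective i ->
  on_same_null_geodesic gt (Phi x) (Phi y) -> on_same_null_geodesic g x y.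
Proof.
move=> i_inj [L' [Lx Ly]].
have [L1 L1x e1] : (i @` sky g x) L' by rewrite sky_image.
have [L2 L2y e2] : (i @` sky g y) L' by rewrite sky_image.
by exists L1; split=> //; rewrite (i_inj L1 L2) // e1 e2.
Qed.

End RayPullback.

(** * Smooth families of light rays *)

Section RaySmoothness.
Context {R : realType} {m : nat} {M : manifold R m.+1} (g : spacetime M).

Lemma ray_smooth_eq (V : normedModType R) (U U0 : set V) (s s0 : V -> light_ray g) :
  open U0 -> U0 `<=` U -> (forall u, U0 u -> s u = s0 u) ->
  ray_smooth U s -> ray_smooth U0 s0.
Proof.
move=> oU0 sU ss H u U0u; have [U' [x [v [oU' U'u U'U [sx sv] tan]]]] := H u (sU u U0u).
exists (U' `&` U0), x, v; split=> //.
- exact: openI.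
- split; first by apply: smooth_map_sub sx => z [].
  by move=> k ak j; apply: Ck_sub (sv k ak j) => z [[]].
- by move=> z [U'z U0z]; rewrite -ss //; exact: tan.
Qed.

Lemma ray_smooth_comp_linear (V V' : normedModType R) (U : set V) (s : V -> light_ray g)
    (L : {linear V' -> V}) : continuous L ->
  ray_smooth U s -> ray_smooth (L @^-1` U) (s \o L).
Proof.
move=> cL H u Uu; have [U' [x [v [oU' U'u U'U [[cx sx] sv] tan]]]] := H _ Uu.
exists (L @^-1` U'), (x \o L), (v \o L); split=> //.
- by apply: open_comp => // z _; exact: cL.
- by move=> z /U'U.
- split; last by move=> k ak j; exact: (Ck_comp_linear cL (sv k ak j)).
  split; last by move=> k ak j; exact: (Ck_comp_linear cL (sx k ak j)).
  by move=> z U'z; apply: continuous_comp; [exact: cL|exact: cx].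
- by move=> z; exact: tan.
Qed.

(** Smooth families are tested on open sets of row vectors, curves on an interval;
    a curve is restricted from the family that depends on one coordinate. *)
Lemma sphere_family_ray_curve (F : R -> 'rV[R]_m -> light_ray g) t w :
  smooth_sphere_family F -> sphere_curve w -> ray_curve (F t \o w).
Proof.
move=> sF [e e0 [sw Sw]]; exists e => //.
pose U : set 'rV[R]_1 := coord_map 0 @^-1` [set a | - e < a < e].
have oI : open [set a : R | - e < a < e].
  rewrite (_ : mkset _ = `]- e, e[%classic); first exact: interval_open.
  by apply/seteqP; split=> a /=; rewrite in_itv.
have oU : open U by apply: open_comp => // z _; exact: coord_map_continuous.
have H := sF 1%N U (fun=> t) (w \o coord_map 0) oU (fun k => Ck_cst _ _ _)
  (fun k => Ck_comp_linear (@coord_map_continuous _ _ _) (sw k)) (fun u Uu => Sw _ Uu).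
have {}H := @ray_smooth_comp_linear _ _ _ _ (row_of_real : {linear R -> 'rV[R]_1}) (@row_of_real_continuous _) H.
apply: ray_smooth_eq oI _ _ H.
- by move=> a; rewrite /U /= /coord_map mxE.
- by move=> a _ /=; rewrite /coord_map mxE.
Qed.

(** Reversal of time, t |-> 1 - t. *)
Lemma legendrian_isotopic_sym (L0 L1 : set (light_ray g) * set (light_ray g)) :
  legendrian_isotopic L0 L1 -> legendrian_isotopic L1 L0.
Proof.
move=> [F [G [[sF sG] leg disj E0 E1]]].
have sfam (H : R -> 'rV[R]_m -> light_ray g) :
    smooth_sphere_family H -> smooth_sphere_family (fun r => H (1 - r)).
  move=> sH k U r w oU sr sw Sw; apply: (sH k U (fun u => 1 - r u) w) => // j.
  have C : Ck j U (fun u => 1 + (-1) * r u).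
    by apply: Ck_add => //; [exact: Ck_cst|apply: Ck_mul => //; exact: Ck_cst].
  by apply: Ck_eq C => // u _; rewrite mulN1r.
exists (fun r => F (1 - r)), (fun r => G (1 - r)); split.
- by split; exact: sfam.
- by move=> t; exact: leg.
- by move=> t; exact: disj.
- by rewrite subr0.
- by rewrite subrr.
Qed.

End RaySmoothness.

(** * Legendrian isotopies under an open contact embedding *)

Section ContactPush.
Context {R : realType} {m : nat} {X Y : manifold R m.+1}.
Variables (g : spacetime X) (h : spacetime Y) (i : light_ray g -> light_ray h).
Hypothesis i_contact : open_contact_embedding i.

(** The ray L0 serves as a default value outside the image of i. *)
Lemma left_inverse_exists (L0 : light_ray g) : exists j, cancel i j.
Proof.
have [i_inj _ _ _] := i_contact.
exists (fun L' => if pselect (exists L, i L = L') is left P then sval (cid P) else L0).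
move=> L; case: pselect => [P|[]]; last by exists L.
exact/i_inj/(svalP (cid P)).
Qed.

Section Inverse.
Variables (j : light_ray h -> light_ray g) (ij : cancel i j).

Lemma range_inverse L' : range i L' -> i (j L') = L'.
Proof. by move=> [L _ <-]; rewrite ij. Qed.

(** The image of i is open and i detects smooth families, so the inverse of i is
    smooth on this image. *)
Lemma ray_smooth_inverse k (U : set 'rV[R]_k) (s : 'rV[R]_k -> light_ray h) :
  open U -> ray_smooth U s ->
  let U0 := U `&` s @^-1` range i in open U0 /\ ray_smooth U0 (j \o s).
Proof.
have [_ oi smi _] := i_contact; move=> oU sU U0.
have oU0 : open U0 by exact: oi.
split=> //; apply/(smi _ _ _ oU0).
apply: ray_smooth_eq oU0 _ _ sU; first by move=> u [].
by move=> u [_ ru] /=; rewrite range_inverse.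
Qed.

Lemma preimage_image_ray T (U : set T) (s : T -> light_ray h) (O : set (light_ray g)) :
  U `&` s @^-1` (i @` O) = (U `&` s @^-1` range i) `&` (j \o s) @^-1` O.
Proof.
apply/seteqP; split=> u /=.
  by move=> [Uu [L OL e]]; split; [split=> //; exists L|rewrite -e ij].
by move=> [[Uu ru] Oj]; split=> //; exists (j (s u)) => //; exact: range_inverse.
Qed.

Lemma ray_open_image O : ray_open O -> ray_open (i @` O).
Proof.
move=> oO k U s oU sU; have [oU0 sU0] := ray_smooth_inverse oU sU.
by rewrite preimage_image_ray; exact: oO.
Qed.

(** The functions that detect velocities on the space of rays of X are transported
    to the image of i. *)
Lemma ray_function_image O f : ray_open O -> ray_function O f ->
  ray_function (i @` O) (f \o j).
Proof.
move=> oO fO k U s oU sU; have [oU0 sU0] := ray_smooth_inverse oU sU.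
by rewrite preimage_image_ray; exact: (fO k _ (j \o s) oU0 sU0).
Qed.

Lemma nonzero_velocity_image s : nonzero_velocity s -> nonzero_velocity (i \o s).
Proof.
move=> [Q [f [oQ Qs fQ df]]]; exists (i @` Q), (f \o j); split.
- exact: ray_open_image.
- by exists (s 0).
- exact: ray_function_image.
- by rewrite (_ : (f \o j) \o (i \o s) = f \o s) //; apply/funext => a /=; rewrite ij.
Qed.

End Inverse.

Lemma smooth_sphere_family_image (F : R -> 'rV[R]_m -> light_ray g) :
  smooth_sphere_family F -> smooth_sphere_family (fun t w => i (F t w)).
Proof.
have [_ _ smi _] := i_contact.
move=> sF k U r w oU sr sw Sw.
exact/(smi k U (fun u => F (r u) (w u)) oU)/(sF k U r w oU sr sw Sw).
Qed.

(** Injectivity persists because i is injective, the other conditions because i is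
    an open embedding that respects smooth families and contact hyperplanes. *)
Lemma legendrian_embedding_image (F : R -> 'rV[R]_m -> light_ray g) t :
  smooth_sphere_family F -> legendrian_embedding (F t) ->
  legendrian_embedding (fun w => i (F t w)).
Proof.
have [i_inj _ _ cont] := i_contact.
move=> sF [F_inj F_top F_imm F_leg].
have [j ij] := left_inverse_exists (F t 0).
split.
- by move=> w w' Sw Sw' /i_inj; exact: F_inj.
- move=> W /F_top[Q oQ WQ]; exists (i @` Q); first exact: ray_open_image.
  move=> w Sw; rewrite (WQ w Sw); split=> [Qw|[L QL /i_inj <-]] //.
- by move=> w Sw dw; apply: (nonzero_velocity_image ij); exact: F_imm.
- move=> w Sw; apply/(cont (F t \o w)); last exact: F_leg.
  exact: sphere_family_ray_curve.
Qed.

Lemma legendrian_isotopic_image (A0 B0 A1 B1 : set (light_ray g)) :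
  legendrian_isotopic (A0, B0) (A1, B1) ->
  legendrian_isotopic (i @` A0, i @` B0) (i @` A1, i @` B1).
Proof.
have [i_inj _ _ _] := i_contact.
move=> [F [G [[sF sG] leg disj [<- <-] [<- <-]]]].
exists (fun t w => i (F t w)), (fun t w => i (G t w)).
have imE (H : R -> 'rV[R]_m -> light_ray g) t :
    (fun w => i (H t w)) @` @sphere R m = i @` (H t @` @sphere R m).
  by rewrite -image_comp.
split.
- by split; exact: smooth_sphere_family_image.
- by move=> t; have [lF lG] := leg t; split; exact: legendrian_embedding_image.
- move=> t; rewrite !imE -subset0 => _ [[L FL <-] [L' GL /i_inj e]].
  have : (F t @` @sphere R m `&` G t @` @sphere R m) L by split=> //; rewrite -e.
  by rewrite disj.
- by rewrite !imE.
- by rewrite !imE.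
Qed.

End ContactPush.

(** * Skies of related and of unrelated events are not isotopic *)

Theorem mainTheorem3 (R : realType) (m : nat) (m_gt1 : (1 < m)%N)
    (X Xt : manifold R m.+1) (g : spacetime X) (gt : spacetime Xt)
    (Phi : X -> Xt) (i : light_ray g -> light_ray gt)
    (g_simple : causally_simple g)
    (g_not_refocussing :
       ~ (exists g' : spacetime X, refocussing g' /\ causally_simple g'))
    (gt_hyperbolic : globally_hyperbolic gt)
    (Phi_embedding : conformal_open_embedding g gt Phi)
    (i_inclusion : ray_inclusion Phi i)
    (i_contact : open_contact_embedding i)
    (related_linked : forall x y : Xt,
       causally_related gt x y -> ~ on_same_null_geodesic gt x y ->
       ~ isotopic_to_unlink (sky_link gt x y))
    (unrelated_in_Xt : forall x y : X,
       causally_unrelated g x y -> causally_unrelated gt (Phi x) (Phi y)) :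
  forall x y u v : X,
    causally_unrelated g x y ->
    causally_related g u v -> ~ on_same_null_geodesic g u v ->
    ~ legendrian_isotopic (sky_link g x y) (sky_link g u v).
Proof.
move=> x y u v unrel rel not_same iso.
have [i_inj _ _ _] := i_contact.
apply: (related_linked (Phi u) (Phi v)).
- exact: (causally_related_image Phi_embedding).
- by move=> /(on_same_null_geodesic_image Phi_embedding i_inclusion i_inj).
- exists (Phi x), (Phi y); split; first exact: unrelated_in_Xt.
  apply: legendrian_isotopic_sym; rewrite /sky_link.
  rewrite -!(sky_image Phi_embedding i_inclusion).
  exact: (legendrian_isotopic_image i_contact).
Qed.
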